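(* Assume that $d\ge3$. Let $\eta_1,\eta_2:\mathbb{R}\to[0,1]$ be two fixed smooth functions such that $$[1,+\infty)\subset\{t:\eta_1(t)=1\}\subset\mathrm{Supp}(\eta_1)\subset[0,+\infty),\qquad[-1/2,1/2]\subset\{t:\eta_2(t)=1\}\subset\mathrm{Supp}(\eta_2)\subset[-1,1],$$ set $\eta(x)=\eta_1(x\cdot e_1)\,\eta_2(x\cdot e_2)$ and $a(x)=\mathrm{Id}+\eta(x)\,e_1\otimes e_1$ for $x\in\mathbb{R}^d$. Let $\phi=(\phi_1,\dots,\phi_d)$ be the unique (up to addition of a constant) strictly sublinear corrector associated with $a$, i.e. $-\mathrm{div}(a(e_j+\nabla\phi_j))=0$ in $\mathbb{R}^d$ for $1\le j\le d$. Then there exists a constant $C>0$ (depending on $d$ and on the fixed functions $\eta_1,\eta_2$) such that for any $r\ge1$ there exist points $x,x'\in\mathbb{R}^d$ satisfying $$|\phi(x)-\phi(x')|\ge C\ln(2+r)\qquad\text{and}\qquad|x-x'|=r.$$ In particular, the corrector $\phi$ is not bounded.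
   Context: $(e_i)$ is the canonical basis of $\mathbb{R}^d$; equations are in the weak sense with solutions in $H^1_{loc}(\mathbb{R}^d)$. A function $f$ is strictly sublinear if $\lim_{r\to\infty}\frac1r\big(\frac{1}{|B(0,r)|}\int_{B(0,r)}|f-\frac{1}{|B(0,r)|}\int_{B(0,r)}f|^2\big)^{1/2}=0$, where $B(0,r)$ is the ball of radius $r$ centered at $0$. (The field $a$ has homogenized matrix $\overline a=\mathrm{Id}$, so the correctors are perturbations of the linear coordinates $x\cdot e_j$.) *)

(* Defs.v *)
(* R^d is the type 'rV[R]_d of row vectors over R : realType.  The canonical
   norm on matrices is the sup norm, hence the separate Euclidean norm enorm;
   both induce the same topology. *)
From HB Require Import structures.
From mathcomp Require Import all_boot all_order all_algebra.
From mathcomp Require Import all_classical all_reals all_analysis.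
Set Implicit Arguments.
Unset Strict Implicit.
Unset Printing Implicit Defensive.
Import Order.TTheory GRing.Theory Num.Theory.
Import numFieldNormedType.Exports.
Local Open Scope classical_set_scope.
Local Open Scope ring_scope.

Fact rV_display : measure_display. Proof. exact: default_measure_display. Qed.

Section borel_rV.
Context {R : realType} (n : nat).

(* The sigma-algebra generated by the coordinates, i.e. the Borel one. *)
Definition rV_measurable : set (set 'rV[R]_n) :=
  g_sigma_preimage (fun (i : 'I_n) (v : 'rV[R]_n) => v 0 i).

Let rV_measurable0 : rV_measurable set0.
Proof. exact: sigma_algebra0. Qed.

Let rV_measurableC A : rV_measurable A -> rV_measurable (~` A).
Proof. exact: sigma_algebraC. Qed.

Let rV_measurable_bigcup (F : (set 'rV[R]_n)^nat) :
  (forall i, rV_measurable (F i)) -> rV_measurable (\bigcup_i F i).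
Proof. exact: sigma_algebra_bigcup. Qed.

HB.instance Definition _ := @isMeasurable.Build rV_display 'rV[R]_n
  rV_measurable rV_measurable0 rV_measurableC rV_measurable_bigcup.

Lemma measurable_coord (i : 'I_n) :
  measurable_fun [set: 'rV[R]_n] (fun v : 'rV[R]_n => v 0 i).
Proof.
move=> _ Y mY; rewrite setTI; apply: sub_sigma_algebra => /=.
rewrite -bigcup_seq/=; exists i => /=; first by rewrite mem_index_enum.
by exists Y => //; rewrite setTI.
Qed.

Lemma measurable_fun_coordP d (T : measurableType d) (f : T -> 'rV[R]_n) :
  (forall i, measurable_fun [set: T] (fun x => f x 0 i)) ->
  measurable_fun [set: T] f.
Proof.
move=> mf _ Y; rewrite setTI.
pose G := [set Y : set 'rV[R]_n | measurable (f @^-1` Y)].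
suff : rV_measurable `<=` G by apply.
apply: smallest_sub.
  split=> [|A|F]; rewrite /G /=.
  - by rewrite preimage_set0.
  - by move=> mA; rewrite setTD preimage_setC; exact: measurableC.
  - by move=> mF; rewrite preimage_bigcup; exact: bigcup_measurable.
rewrite -bigcup_seq => A [i _ [B mB <-]].
by rewrite /G /= setTI -[X in measurable X]setTI; exact: (mf i).
Qed.

End borel_rV.

Section lebesgue_step.
Context {R : realType} (n : nat).
Variable mu : {sigma_finite_measure set 'rV[R]_n -> \bar R}.

Definition rV_cons (p : measurableTypeR R * 'rV[R]_n) : 'rV[R]_n.+1 :=
  \row_(i < n.+1) oapp (fun j : 'I_n => p.2 0 j) p.1 (unlift ord0 i).

Let rV_uncons (v : 'rV[R]_n.+1) : measurableTypeR R * 'rV[R]_n :=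
  (v 0 ord0, \row_(j < n) v 0 (lift ord0 j)).

Let rV_unconsK : cancel rV_uncons rV_cons.
Proof.
move=> v; apply/rowP => i; rewrite mxE /=.
by case: unliftP => [j ->|->] //=; rewrite mxE.
Qed.

Let rV_consK : cancel rV_cons rV_uncons.
Proof.
move=> [x v]; rewrite /rV_uncons !mxE unlift_none /=; congr pair.
by apply/rowP => j; rewrite !mxE liftK.
Qed.

Lemma measurable_rV_cons : measurable_fun setT rV_cons.
Proof.
apply: measurable_fun_coordP => i.
case: (unliftP ord0 i) => [j|] ->.
  rewrite (_ : (fun _ => _) = (fun v : 'rV[R]_n => v 0 j) \o snd).
    by apply: measurableT_comp => //; exact: measurable_coord.
  by apply/funext => p; rewrite mxE liftK.
rewrite (_ : (fun _ => _) = fst) ; first exact: measurable_fst.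
by apply/funext => p; rewrite mxE unlift_none.
Qed.

Let measurable_rV_uncons : measurable_fun setT rV_uncons.
Proof.
apply/measurable_fun_pair; first exact: measurable_coord.
apply: measurable_fun_coordP => i.
rewrite (_ : (fun _ => _) = (fun v : 'rV[R]_n.+1 => v 0 (lift ord0 i))).
  exact: measurable_coord.
by apply/funext => v; rewrite mxE.
Qed.

(* The product of the Lebesgue measure of R with mu, carried to R^(n+1) by
   (x, v) |-> (x, v_1, ..., v_n). *)
Definition lebesgue_step : set 'rV[R]_n.+1 -> \bar R :=
  pushforward (lebesgue_measure \x mu)%E rV_cons.

Let lebesgue_step0 : lebesgue_step set0 = 0%E.
Proof. by rewrite /lebesgue_step /pushforward preimage_set0 measure0. Qed.

Let lebesgue_step_ge0 A : (0 <= lebesgue_step A)%E.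
Proof. exact: (measure_ge0 (lebesgue_measure \x mu)%E). Qed.

Let lebesgue_step_sigma_additive : semi_sigma_additive lebesgue_step.
Proof.
exact: (@measure_semi_sigma_additive _ _ _
  (measure_function_pushforward__canonical__measure_function_Measure
    (lebesgue_measure \x mu)%E measurable_rV_cons)).
Qed.

HB.instance Definition _ := isMeasure.Build _ _ _ lebesgue_step
  lebesgue_step0 lebesgue_step_ge0 lebesgue_step_sigma_additive.

Let lebesgue_step_sigma_finite : sigma_finite setT lebesgue_step.
Proof.
have /sigma_finiteP[F [TF ndF Foo]] :=
  @sigma_finiteT _ _ _ (@lebesgue_measure R).
have /sigma_finiteP[G [TG ndG Goo]] := sigma_finiteT mu.
exists (fun k => rV_uncons @^-1` (F k `*` G k)).
  rewrite -preimage_bigcup (_ : \bigcup_k _ = setT) ?preimage_setT//.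
  rewrite -setXTT TF TG predeqE => -[x y]; split.
    by move=> [n' _ []/= ? ?]; split; exists n'.
  move=> [/= [i _ Fix] [k _ Gky]]; exists (maxn i k) => //; split.
  - by move: x Fix; exact/subsetPset/ndF/leq_maxl.
  - by move: y Gky; exact/subsetPset/ndG/leq_maxr.
move=> k; have [mF Fk] := Foo k; have [mG Gk] := Goo k; split.
  rewrite -[X in measurable X]setTI; apply: measurable_rV_uncons => //.
  exact: measurableX.
rewrite /lebesgue_step /pushforward -comp_preimage.
rewrite (_ : rV_uncons \o rV_cons = id); last first.
  by apply/funext => p /=; rewrite rV_consK.
by rewrite preimage_id product_measure1E// lte_mul_pinfty// ge0_fin_numE.
Qed.

HB.instance Definition _ := Measure_isSigmaFinite.Build _ _ _ lebesgue_step
  lebesgue_step_sigma_finite.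

End lebesgue_step.

Fixpoint lebesgue_rV (R : realType) (n : nat) :
    {sigma_finite_measure set 'rV[R]_n -> \bar R} :=
  match n with
  | 0 => \d_(0 : 'rV[R]_0)
  | m.+1 => lebesgue_step (lebesgue_rV R m)
  end.

Lemma measurable_box (R : realType) (n : nat) (A : 'I_n -> set R) :
  (forall i, measurable (A i)) ->
  measurable [set v : 'rV[R]_n | forall i, A i (v 0 i)].
Proof.
move=> mA; rewrite (_ : [set _ | _] = \big[setI/setT]_(i < n)
    ((fun v : 'rV[R]_n => v 0 i) @^-1` (A i))).
  apply: bigsetI_measurable => i _.
  by rewrite -[X in measurable X]setTI; exact: measurable_coord.
rewrite -bigcap_seq; apply/seteqP; split => v /= h i; first by move=> _; exact: h.
by apply: h; rewrite /= mem_index_enum.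
Qed.

Lemma lebesgue_rV_box (R : realType) (n : nat) (A : 'I_n -> set R) :
  (forall i, measurable (A i)) ->
  lebesgue_rV R n [set v | forall i, A i (v 0 i)] =
  (\prod_(i < n) lebesgue_measure (A i))%E.
Proof.
elim: n A => [|n IHn] A mA.
  rewrite big_ord0 /= diracE (_ : 0 \in _) //.
  by rewrite inE => -[].
rewrite big_ord_recl -IHn // -product_measure1E; last 2 first.
- exact: mA.
- exact: (@measurable_box _ _ (fun i => A (lift ord0 i))).
rewrite [LHS]/= /lebesgue_step /pushforward; congr (product_measure1 _ _ _).
apply/seteqP; split => [[x v] /= h|[x v] /= [h0 h] i].
  split; first by have := h ord0; rewrite mxE unlift_none.
  by move=> i; have := h (lift ord0 i); rewrite mxE liftK.
by rewrite mxE /=; case: unliftP => [j|] ->.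
Qed.

Section euclidean.
Context {R : realType} {d : nat}.
Implicit Types (f g : 'rV[R]_d -> R) (x y : 'rV[R]_d).

Local Notation leb := (lebesgue_rV R d).

Definition dot x y : R := \sum_(i < d) x 0 i * y 0 i.
Definition enorm x : R := Num.sqrt (dot x x).
Definition eball (r : R) : set 'rV[R]_d := [set x | enorm x < r].
Definition ebasis (i : 'I_d) : 'rV[R]_d := delta_mx 0 i.

Definition partial (i : 'I_d) f : 'rV[R]_d -> R := fun x => 'D_(ebasis i) f x.
Definition grad f x : 'rV[R]_d := \row_i partial i f x.

(* C^oo: the iterated partial derivatives of every order exist and are
   continuous. *)
Definition smooth_rV f : Prop := forall s : seq 'I_d,
  let h := foldr partial f s in
  continuous h /\ forall (i : 'I_d) x, derivable h x (ebasis i).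

Definition test_function f : Prop :=
  smooth_rV f /\ compact (closure [set x | f x != 0]).

Definition L2loc f : Prop :=
  measurable_fun setT f /\
  forall r : R, 0 < r -> (\int[leb]_(x in eball r) ((f x) ^+ 2)%:E < +oo)%E.

Definition weak_gradient f (g : 'rV[R]_d -> 'rV[R]_d) : Prop :=
  forall (i : 'I_d) (psi : 'rV[R]_d -> R), test_function psi ->
    \int[leb]_x (f x * partial i psi x) = - \int[leb]_x (g x 0 i * psi x).

(* f belongs to H^1_loc(R^d) and g is (a representative of) its gradient. *)
Definition H1loc f (g : 'rV[R]_d -> 'rV[R]_d) : Prop :=
  [/\ L2loc f, forall i, L2loc (fun x => g x 0 i) & weak_gradient f g].

(* - div F = 0 in R^d, tested against C_c^oo functions. *)
Definition weak_div_free (F : 'rV[R]_d -> 'rV[R]_d) : Prop :=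
  forall psi : 'rV[R]_d -> R, test_function psi ->
    \int[leb]_x dot (F x) (grad psi x) = 0.

(* - div (a (e_j + grad phi)) = 0; vectors are rows, so that a matrix A maps
   v to v *m A^T. *)
Definition corrector (a : 'rV[R]_d -> 'M[R]_d) (j : 'I_d) f : Prop :=
  exists2 g, H1loc f g &
    weak_div_free (fun x => (ebasis j + g x) *m (a x)^T).

Definition average (r : R) f : R :=
  (fine (leb (eball r)))^-1 * \int[leb]_(x in eball r) f x.

Definition strictly_sublinear f : Prop :=
  r^-1 * Num.sqrt (average r (fun x => `|f x - average r f| ^+ 2))
    @[r --> +oo%R] --> (0 : R).

End euclidean.

Definition smooth_R (R : realType) (f : R -> R) : Prop :=
  forall (n : nat) (t : R), derivable (derive1n n f) t 1.

Definition supp (R : realType) (f : R -> R) : set R :=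
  closure [set t | f t != 0].

Section coefficients.
Context {R : realType} {d : nat} (hd : (3 <= d)%N).

Definition e_1 : 'rV[R]_d := ebasis (Ordinal (ltnW (ltnW hd))).
Definition e_2 : 'rV[R]_d := ebasis (Ordinal (ltnW hd)).

Definition eta (eta1 eta2 : R -> R) (x : 'rV[R]_d) : R :=
  eta1 (dot x e_1) * eta2 (dot x e_2).

Definition acoef (eta1 eta2 : R -> R) (x : 'rV[R]_d) : 'M[R]_d :=
  1%:M + eta eta1 eta2 x *: (e_1^T *m e_1).

End coefficients.

(* Main.v *)
Require Import Defs.
From HB Require Import structures.
From mathcomp Require Import all_boot all_order all_algebra.
From mathcomp Require Import all_classical all_reals all_analysis.
From mathcomp Require Import measurable_realfun lra ring.
Set Implicit Arguments.
Unset Strict Implicit.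
Unset Printing Implicit Defensive.
Import Order.TTheory GRing.Theory Num.Theory.
Import numFieldNormedType.Exports.
Local Open Scope classical_set_scope.
Local Open Scope ring_scope.

(** Only the first corrector [f = phi_1] matters, since
    [|f x - f x'| <= |phi x - phi x'|].  Moving all the derivatives of its
    equation onto a test function [psi] gives, for every constant [c],
      int (f - c) (L psi) = - int psi (d_1 eta),
      where  L psi = Laplacian psi + d_1 (eta d_1 psi).
    The right-hand side is a source [d_1 eta = eta1'(x_1) eta2(x_2)] of
    positive mass, concentrated near the origin of the [(x_1, x_2)] plane and
    constant along the other [d - 2] directions; the fundamental solution of
    the Laplacian of the plane is a logarithm, which is the reason for the
    growth.

    To make this quantitative without regularity theory, [psi] is a
    logarithmic cutoff at scale [rho = 4 ^ n]:
      psi = eta2 (ln (1 + x_1^2 + x_2^2) / ln rho)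
            * eta2 ((x_3^2 + ... + x_d^2) / rho^2).
    Its first factor equals [1] on the source, so [int psi (d_1 eta)] is at
    least of order [rho ^ (d-2)] ([source_lower_bound]).  On the other hand
    [ln (1 + x_1^2 + x_2^2)] is almost harmonic in the plane, the second
    derivatives of the second factor are of order [rho^-2] on a support of
    extent only [sqrt rho] in [(x_1, x_2)], and the perturbation
    [d_1 (eta d_1 psi)] lives in the strip [|x_2| <= 1], where the second
    derivatives of the logarithm are integrable.  Hence [int |L psi|] is
    at most of order [rho ^ (d-2) / n] ([operator_bound],
    [dyadic_mass_bound]).  Comparing the two, [f] deviates from any constant
    by at least a multiple of [n] on the box of size [rho]
    ([scale_le_oscillation]).

    Finally, if [|f x - f x'| <= K] whenever [|x - x'| = r], then
    [|f x - f x'| <= 2 K] whenever [|x - x'| <= 2 r], because such points have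
    a common point at distance [r]; a number of steps depending only on [d]
    reaches the whole box with [4 ^ n <= 16 r < 4 ^ (n+1)]
    ([oscillation_chain]), so that [K] is at least a multiple of [n], hence of
    [ln (2 + r)].  The argument uses [f] pointwise only through this chain and
    otherwise through integrals, so it applies to every representative of the
    corrector. *)

(** * Directional derivatives and elementary smooth functions *)

(** A directional derivative is the derivative at [0] of the restriction to a
    line; this brings the one-variable chain rule to functions on [R^d]. *)
Lemma is_derive_line (R : numFieldType) (V W : normedModType R) (f : V -> W)
    (x v : V) (df : W) :
  is_derive x v f df <-> is_derive (0 : R) 1 (fun h : R => f (h *: v + x)) df.
Proof.
have E : (fun h : R => h^-1 *: ((f \o shift x) (h *: v) - f x)) =
    (fun h : R => h^-1 *: (((fun h : R => f (h *: v + x)) \o shift 0) (h *: 1)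
      - f (0 *: v + x))).
  by apply/funext => h /=; rewrite scale0r add0r addr0 [h *: 1]mulr1.
split=> -[df1 df2]; split.
- by rewrite /derivable -E.
- by rewrite /derive -E.
- by rewrite /derivable E.
- by rewrite /derive E.
Qed.

Lemma is_derive_chain (R : realType) (V : normedModType R) (f : V -> R)
    (h : R -> R) (x v : V) (df dh : R) :
  is_derive x v f df -> is_derive (f x) 1 h dh ->
  is_derive x v (fun y => h (f y)) (dh * df).
Proof.
move=> /is_derive_line df0 dh0; apply/is_derive_line.
have E : f x = f (0 *: v + x) by rewrite scale0r add0r.
rewrite E in dh0.
exact: is_derive1_comp.
Qed.

(** A syntactic class of smooth functions, closed under partial derivatives and
    under freezing the first coordinate.  Membership yields smoothness,
    continuity and measurability at once, by induction on the derivation. *)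
Inductive elementary (R : realType) (n : nat) : ('rV[R]_n -> R) -> Prop :=
| elementary_cst c : elementary (fun=> c)
| elementary_coord i : elementary (fun x => x 0 i)
| elementaryD f g : elementary f -> elementary g ->
    elementary (fun x => f x + g x)
| elementaryM f g : elementary f -> elementary g ->
    elementary (fun x => f x * g x)
| elementary_comp h f : smooth_R h -> elementary f ->
    elementary (fun x => h (f x))
| elementary_ln f : (forall x, 0 < f x) -> elementary f ->
    elementary (fun x => ln (f x))
| elementaryV f : (forall x, 0 < f x) -> elementary f ->
    elementary (fun x => (f x)^-1).

Lemma smooth_R_derive1 (R : realType) (h : R -> R) :
  smooth_R h -> smooth_R (derive1 h).
Proof. by move=> sh n t; have := sh n.+1 t; rewrite derive1Sn. Qed.

Lemma smooth_R_is_derive (R : realType) (h : R -> R) (t : R) :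
  smooth_R h -> is_derive t 1 h (derive1 h t).
Proof.
by move=> sh; rewrite derive1E; apply: derivableP; exact: (sh 0 t).
Qed.

Lemma smooth_R_continuous (R : realType) (h : R -> R) :
  smooth_R h -> continuous h.
Proof.
move=> sh t; apply: differentiable_continuous.
by apply/derivable1_diffP; exact: (sh 0 t).
Qed.

Section elementary_theory.
Context {R : realType} {n : nat}.
Implicit Types (f g : 'rV[R]_n -> R) (i j : 'I_n) (x : 'rV[R]_n).

Lemma is_derive_coord i j x :
  is_derive x (ebasis j) (fun y : 'rV[R]_n => y 0 i) ((i == j)%:R : R).
Proof.
apply/is_derive_line.
have E : (fun h : R => (h *: ebasis j + x) 0 i) =
    (fun h : R => (i == j)%:R * h + x 0 i).
  by apply/funext => h; rewrite !mxE mulrC eq_sym eqxx eq_sym.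
rewrite E.
apply: (@is_derive_eq _ _ _ ((i == j)%:R *: id + cst (x 0 i))).
by rewrite addr0 [_ *: _]mulr1.
Qed.

Lemma is_derive_ln f x v df : 0 < f x -> is_derive x v f df ->
  is_derive x v (fun y => ln (f y)) ((f x)^-1 * df).
Proof.
by move=> f0 fd; apply: (is_derive_chain fd); exact: is_derive1_ln.
Qed.

Lemma is_derive_inv f x v df : 0 < f x -> is_derive x v f df ->
  is_derive x v (fun y => (f y)^-1) (- (f x)^-1 * (f x)^-1 * df).
Proof.
move=> f0 fd; apply: (is_derive_chain fd).
apply: is_derive_eq; first by apply: is_deriveV; rewrite gt_eqF.
by rewrite [_ *: _]mulr1 -exprVn expr2 mulNr.
Qed.

Lemma partial_at i f x df : is_derive x (ebasis i) f df -> partial i f x = df.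
Proof. by case. Qed.

Lemma partial_val i f f' :
  (forall x, is_derive x (ebasis i) f (f' x)) -> partial i f = f'.
Proof. by move=> d; apply/funext => x; exact: partial_at. Qed.

Lemma elementary_continuous f : elementary f -> continuous f.
Proof.
elim=> {f} [c|i|f g _ cf _ cg|f g _ cf _ cg|h f sh _ cf|f f0 _ cf|f f0 _ cf] x.
- exact: cst_continuous.
- exact: coord_continuous.
- exact: (continuousD (cf x) (cg x)).
- exact: (continuousM (cf x) (cg x)).
- exact: (continuous_comp (cf x) (@smooth_R_continuous _ h sh (f x))).
- exact: (continuous_comp (cf x) (continuous_ln (f0 x))).
- by apply: (@continuousV _ _ f x _ (cf x)); rewrite gt_eqF.
Qed.

(** Induction on the derivation: each rule of differentiation stays inside the
    class. *)
Lemma elementary_partial f i : elementary f ->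
  elementary (partial i f) /\ forall x, derivable f x (ebasis i).
Proof.
pose P (f : 'rV[R]_n -> R) := exists2 f', elementary f' &
  forall x, is_derive x (ebasis i) f (f' x).
suff PE f' : elementary f' -> P f'.
  by move=> /PE[f' ef' ff']; rewrite (partial_val ff').
elim=> {f f'} [c|j|f g ef [f' ef' ff'] eg [g' eg' gg']
  |f g ef [f' ef' ff'] eg [g' eg' gg']
  |h f sh ef [f' ef' ff']|f f0 ef [f' ef' ff']|f f0 ef [f' ef' ff']].
- by exists (fun=> 0) => [|x]; [exact: elementary_cst|exact: is_derive_cst].
- exists (fun=> (j == i)%:R) => [|x]; first exact: elementary_cst.
  exact: is_derive_coord.
- exists (fun x => f' x + g' x) => [|x]; first exact: elementaryD.
  exact: is_deriveD.
- exists (fun x => f x * g' x + g x * f' x) => [|x].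
    by apply: elementaryD; exact: elementaryM.
  exact: is_deriveM.
- exists (fun x => derive1 h (f x) * f' x) => [|x].
    by apply: elementaryM => //; apply: elementary_comp => //;
      exact: smooth_R_derive1.
  by apply: is_derive_chain => //; exact: smooth_R_is_derive.
- exists (fun x => (f x)^-1 * f' x) => [|x].
    by apply: elementaryM => //; exact: elementaryV.
  exact: is_derive_ln.
- exists (fun x => -1 * (f x)^-1 * (f x)^-1 * f' x) => [|x].
    apply: elementaryM => //; apply: elementaryM; last exact: elementaryV.
    by apply: elementaryM; [exact: elementary_cst|exact: elementaryV].
  by rewrite mulN1r; exact: is_derive_inv.
Qed.

Lemma elementary_smooth f : elementary f -> smooth_rV f.
Proof.
move=> ef s h; have eh : elementary h.
  by rewrite /h; elim: s {h} => [//|i s IH] /=; have [] := elementary_partial i IH.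
split; first exact: elementary_continuous.
by move=> i; have [] := elementary_partial i eh.
Qed.

Lemma elementary_measurable f : elementary f -> measurable_fun setT f.
Proof.
elim=> {f} [c|i|f g _ mf _ mg|f g _ mf _ mg|h f sh _ mf|f f0 _ mf|f f0 _ mf].
- exact: measurable_cst.
- exact: measurable_coord.
- exact: measurable_funD.
- exact: measurable_funM.
- apply: (measurableT_comp _ mf); apply: continuous_measurable_fun.
  exact: smooth_R_continuous.
- exact: (measurableT_comp (@measurable_ln R) mf).
- have -> : (fun x => (f x)^-1) = (fun x => expR (- ln (f x))).
    by apply/funext => x; rewrite expRN lnK// posrE.
  apply: (measurableT_comp (@measurable_expR R)).
  by apply: measurable_funN; exact: (measurableT_comp (@measurable_ln R) mf).
Qed.

End elementary_theory.

(** * Boxes, bounded supports and integrability *)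

Definition bounded_support (R : realType) (n : nat) (f : 'rV[R]_n -> R) :=
  exists M : R, forall x, f x != 0 -> forall i, `|x 0 i| <= M.

(** Side lengths depend on the direction: the estimates below use boxes that are
    dyadic in the first two coordinates only. *)
Definition box (R : realType) (n : nat) (m : 'I_n -> R) : set 'rV[R]_n :=
  [set x | forall i, `|x 0 i| <= m i].

Section boxes.
Context {R : realType} {n : nat}.
Implicit Types (f g : 'rV[R]_n -> R) (m : 'I_n -> R).

Local Notation leb := (lebesgue_rV R n).

Lemma boxE m : box m = [set x | forall i, `[- m i, m i]%classic (x 0 i)].
Proof.
by apply/seteqP; split=> x /= h i; have := h i; rewrite in_itv /= ler_norml.
Qed.

Lemma measurable_boxn m : measurable (box m).
Proof.
by rewrite boxE; apply: (@measurable_box _ _ (fun i => `[- m i, m i]%classic)).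
Qed.

Lemma lebesgue_box m : (forall i, 0 <= m i) ->
  leb (box m) = (\prod_i (m i *+ 2))%:E.
Proof.
move=> m0; rewrite boxE (@lebesgue_rV_box _ _ (fun i => `[- m i, m i]%classic))//.
rewrite -prodEFin; apply: eq_bigr => i _.
rewrite lebesgue_measure_itv /= lte_fin.
case: ifPn => [_|]; first by rewrite -EFinD opprK mulr2n.
rewrite -leNgt => mi.
have -> : m i = 0 by have := m0 i; lra.
by rewrite mul0rn.
Qed.

Lemma compact_boxn m : compact (box m).
Proof.
rewrite boxE; apply: (@rV_compact _ _ (fun i => `[- m i, m i]%classic)) => i.
exact: segment_compact.
Qed.

Lemma elementary_test_function f :
  elementary f -> bounded_support f -> test_function f.
Proof.
move=> ef [M fM]; split; first exact: elementary_smooth.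
have cB := @compact_boxn (fun=> M).
apply: (subclosed_compact (@closed_closure _ _) cB).
have clB : closed (@box R n (fun=> M)).
  by apply: compact_closed cB; exact: norm_hausdorff.
rewrite (proj1 (closure_id _) clB).
exact: closure_subset.
Qed.

(** The extreme value theorem on a box, applied to [f ^ 2] to handle both signs. *)
Lemma elementary_bounded f : elementary f -> bounded_support f ->
  exists2 K : R, 0 <= K & forall x, `|f x| <= K.
Proof.
move=> ef [M fM].
pose g x := f x * f x.
have g0 x : 0 <= g x by rewrite /g -expr2 sqr_ge0.
have cg : continuous g by apply: elementary_continuous; exact: elementaryM.
have [|c _ cmax] := @EVT_max_rV R n g (box (fun=> `|M|)) _
  (@compact_boxn _) (continuous_subspaceT cg).
  by exists 0 => i; rewrite mxE normr0.
exists (g c + 1) => [|x]; first by rewrite addr_ge0.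
have [->|fx0] := eqVneq (f x) 0.
  by rewrite normr0 addr_ge0.
apply: (@le_trans _ _ (g x + 1)).
  by rewrite /g -expr2 -real_normK ?num_real//; nra.
rewrite lerD2r; apply: cmax; rewrite inE => i.
by apply: le_trans (fM _ fx0 i) _; exact: ler_norm.
Qed.

Lemma elementary_sum (I : Type) (s : seq I) (P : pred I) (F : I -> 'rV[R]_n -> R) :
  (forall i, P i -> elementary (F i)) ->
  elementary (fun x => \sum_(i <- s | P i) F i x).
Proof.
move=> eF; elim: s => [|i s IH].
  have -> : (fun x => \sum_(i <- [::] | P i) F i x) = (fun=> 0).
    by apply/funext => x; rewrite big_nil.
  exact: elementary_cst.
have -> : (fun x => \sum_(j <- i :: s | P j) F j x) =
    if P i then (fun x => F i x + \sum_(j <- s | P j) F j x)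
    else (fun x => \sum_(j <- s | P j) F j x).
  by apply/funext => x; rewrite big_cons; case: (P i).
by case: ifP => // Pi; apply: elementaryD => //; exact: eF.
Qed.

Lemma elementary_dot : elementary (fun x : 'rV[R]_n => dot x x).
Proof.
by apply: elementary_sum => i _; apply: elementaryM; exact: elementary_coord.
Qed.

Lemma dotxx_ge0 (x : 'rV[R]_n) : 0 <= dot x x.
Proof. by apply: sumr_ge0 => i _; rewrite -expr2 sqr_ge0. Qed.

Lemma enorm_sqr (x : 'rV[R]_n) : enorm x ^+ 2 = dot x x.
Proof. exact: sqr_sqrtr (dotxx_ge0 x). Qed.

Lemma coord_le_enorm (x : 'rV[R]_n) i : `|x 0 i| <= enorm x.
Proof.
rewrite -[leLHS]sqrtr_sqr ler_wsqrtr// /dot (bigD1 i)//= -expr2 lerDl.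
by apply: sumr_ge0 => j _; rewrite -expr2 sqr_ge0.
Qed.

Lemma measurable_eball (r : R) : measurable (eball r : set 'rV[R]_n).
Proof.
have -> : eball r = (fun x : 'rV[R]_n => Num.sqrt (dot x x)) @^-1` `]-oo, r[.
  by apply/seteqP; split=> x /=; rewrite in_itv.
rewrite -[X in measurable X]setTI.
have mdot := elementary_measurable elementary_dot.
have msqrt := continuous_measurable_fun (@sqrt_continuous R).
have := measurableT_comp msqrt mdot.
by apply => //.
Qed.

Lemma lebesgue_eball_lty (r : R) : (leb (eball r) < +oo)%E.
Proof.
have sub : (eball r : set 'rV[R]_n) `<=` box (fun=> `|r|).
  move=> x xr i; apply: (le_trans (coord_le_enorm x i)).
  by apply: (le_trans (ltW xr)); exact: ler_norm.
apply: (@le_lt_trans _ _ (leb (box (fun=> `|r|)))).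
  by apply: le_measure => //; rewrite inE; [exact: measurable_eball|
    exact: measurable_boxn].
by rewrite lebesgue_box// ltry.
Qed.

(** On a ball containing the support of [g], [|f g|] is dominated by
    [sup |g| (f ^ 2 + 1)]. *)
Lemma L2locM_integrable f g : L2loc f -> elementary g -> bounded_support g ->
  leb.-integrable setT (fun x => (f x * g x)%:E).
Proof.
move=> [mf f2] eg bg; have [K K0 gK] := elementary_bounded eg bg.
have [M gM] := bg.
pose r : R := Num.sqrt (n%:R * M ^+ 2) + 1.
have r0 : 0 < r by rewrite ltr_wpDl ?sqrtr_ge0.
have supp_r x : g x != 0 -> eball r x.
  move=> /gM xM; rewrite /eball /= ltr_pwDr// ler_wsqrtr//.
  have -> : n%:R * M ^+ 2 = \sum_(i < n) M ^+ 2.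
    by rewrite sumr_const card_ord mulr_natl.
  apply: ler_sum => i _; rewrite -expr2 -real_normK ?num_real//.
  have := xM i; have := normr_ge0 (x 0 i); nra.
have intK : leb.-integrable (eball r) (fun x => (K * (f x ^+ 2 + 1))%:E).
  have me := measurable_eball r.
  have mf2 : measurable_fun setT (fun x => f x ^+ 2) by exact: measurable_funX.
  have -> : (fun x => (K * (f x ^+ 2 + 1))%:E) =
      (fun x => K%:E * ((EFin \o (fun x => f x ^+ 2)%R) \+ cst 1%E) x)%E.
    by apply/funext => x /=; rewrite EFinM EFinD.
  apply: integrableZl => //; apply: integrableD => //.
    apply/integrableP; split; first by apply: measurable_funTS; exact/measurable_EFinP.
    have := f2 r r0; congr (_ < _)%E; apply: eq_integral => x _.
    by rewrite /= ger0_norm// sqr_ge0.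
  apply/integrableP; split; first exact: measurable_cst.
  by rewrite integral_cst//= normr1 mul1e; exact: lebesgue_eball_lty.
have mfg : measurable_fun setT (fun x => (f x * g x)%:E).
  by apply/measurable_EFinP; apply: measurable_funM => //;
    exact: elementary_measurable.
rewrite (integrable_mkcond _ (measurable_eball r)) in intK.
apply: le_integrable intK => // x _.
rewrite /patch; case: ifPn => [_|].
  rewrite /= lee_fin normrM [leRHS]ger0_norm; last first.
    by rewrite mulr_ge0// addr_ge0// sqr_ge0.
  apply: (@le_trans _ _ (`|f x| * K)); first by rewrite ler_wpM2l.
  rewrite mulrC ler_wpM2l// -real_normK ?num_real//; nra.
rewrite notin_setE => xr.
have [->|/supp_r//] := eqVneq (g x) 0.
by rewrite mulr0.
Qed.

Lemma L2loc_cst (c : R) : L2loc (fun _ : 'rV[R]_n => c).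
Proof.
split; first exact: measurable_cst.
move=> r _; rewrite integral_cst; last exact: measurable_eball.
by rewrite lte_mul_pinfty ?lee_fin ?sqr_ge0//; exact: lebesgue_eball_lty.
Qed.

Lemma elementary_integrable f : elementary f -> bounded_support f ->
  leb.-integrable setT (fun x => (f x)%:E).
Proof.
move=> ef bf; have := L2locM_integrable (L2loc_cst 1) ef bf.
by under eq_fun do rewrite mul1r.
Qed.

End boxes.

(** * Slices and Fubini's theorem on R^d *)

(** Outside the box, the function vanishes on a neighbourhood of the point. *)
Lemma bounded_support_partial (R : realType) (n : nat) (f : 'rV[R]_n -> R) i :
  bounded_support f -> bounded_support (partial i f).
Proof.
move=> [M fM]; exists M => x; apply: contra_neqP => /existsNP[j].
move/negP; rewrite -ltNge => xj.
have near0 : \forall y \near x, f y = 0.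
  have cx : `|y 0 j| @[y --> x] --> `|x 0 j|.
    by apply: cvg_norm; exact: coord_continuous.
  near=> y; apply/eqP/negPn/negP => /fM/(_ j).
  rewrite leNgt => /negP; apply; near: y.
  exact: cvgr_gt xj.
rewrite /partial (@near_eq_derive _ _ _ f (cst 0)) ?derive_cst//.
Unshelve. all: by end_near. Qed.

Section slices.
Context {R : realType} {n : nat}.
Implicit Types (f : 'rV[R]_n.+1 -> R) (t : R) (v : 'rV[R]_n).

Lemma rV_cons0 t v : rV_cons (t, v) 0 ord0 = t.
Proof. by rewrite mxE unlift_none. Qed.

Lemma rV_consS t v j : rV_cons (t, v) 0 (lift ord0 j) = v 0 j.
Proof. by rewrite mxE liftK. Qed.

Lemma rV_cons_shift0 h t v :
  h *: ebasis ord0 + rV_cons (t, v) = rV_cons (h + t, v).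
Proof.
apply/rowP => i; rewrite [LHS]mxE [X in X + _]mxE [X in _ * X]mxE eqxx /=.
case: (unliftP ord0 i) => [j|] ->; first by rewrite !rV_consS/= mulr0 add0r.
by rewrite !rV_cons0 eqxx mulr1.
Qed.

Lemma rV_cons_shiftS h t v j :
  h *: ebasis (lift ord0 j) + rV_cons (t, v) = rV_cons (t, h *: ebasis j + v).
Proof.
apply/rowP => i; rewrite [LHS]mxE [X in X + _]mxE [X in _ * X]mxE eqxx /=.
case: (unliftP ord0 i) => [k|] ->; last by rewrite !rV_cons0 mulr0 add0r.
by rewrite !rV_consS !mxE eqxx /= (inj_eq (@lift_inj _ _)).
Qed.

Lemma elementary_slice f t : elementary f ->
  elementary (fun v => f (rV_cons (t, v))).
Proof.
elim=> {f} [c|i|f g _ ef _ eg|f g _ ef _ eg|h f sh _ ef|f f0 _ ef|f f0 _ ef].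
- exact: elementary_cst.
- case: (unliftP ord0 i) => [j|] ->.
    under eq_fun do rewrite rV_consS; exact: elementary_coord.
  under eq_fun do rewrite rV_cons0; exact: elementary_cst.
- exact: elementaryD.
- exact: elementaryM.
- exact: elementary_comp.
- by apply: elementary_ln => // v; exact: f0.
- by apply: elementaryV => // v; exact: f0.
Qed.

Lemma bounded_support_slice f t : bounded_support f ->
  bounded_support (fun v => f (rV_cons (t, v))).
Proof.
by move=> [M fM]; exists M => v fv i; have := fM _ fv (lift ord0 i); rewrite rV_consS.
Qed.

(** The direction [ebasis (lift ord0 j)] is tangent to the slice, which allows
    inductions on the dimension. *)
Lemma partial_slice f t v j :
  partial (lift ord0 j) f (rV_cons (t, v)) =
  partial j (fun v => f (rV_cons (t, v))) v.
Proof.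
have E : (fun h : R => h^-1 *: ((f \o shift (rV_cons (t, v)))
      (h *: ebasis (lift ord0 j)) - f (rV_cons (t, v)))) =
    (fun h : R => h^-1 *: (((fun v => f (rV_cons (t, v))) \o shift v)
      (h *: ebasis j) - f (rV_cons (t, v)))).
  by apply/funext => h /=; rewrite rV_cons_shiftS.
by rewrite /partial /derive E.
Qed.

Lemma is_derive_slice f t v : elementary f ->
  is_derive t 1 (fun t => f (rV_cons (t, v))) (partial ord0 f (rV_cons (t, v))).
Proof.
move=> ef; have [_ df] := elementary_partial ord0 ef.
apply: (proj2 (is_derive_line _ _ _ _)).
have -> : (fun h : R => f (rV_cons (h *: 1 + t, v))) =
    (fun h : R => f (h *: ebasis ord0 + rV_cons (t, v))).
  by apply/funext => h; rewrite [h *: 1]mulr1 rV_cons_shift0.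
apply: (proj1 (is_derive_line _ _ _ _)).
by apply: derivableP; exact: df.
Qed.

Lemma continuous_slice f v : elementary f ->
  continuous (fun t : R => f (rV_cons (t, v))).
Proof.
move=> ef t; apply: differentiable_continuous; apply/derivable1_diffP.
exact: (@ex_derive _ _ _ _ _ _ _ (is_derive_slice t v ef)).
Qed.

End slices.

(** [lebesgue_rV R n.+1] is by definition the image of the product of the line
    and [lebesgue_rV R n] under [rV_cons]. *)
Section fubini.
Context {R : realType} {n : nat}.
Variable f : 'rV[R]_n.+1 -> R.
Hypothesis intf : (lebesgue_rV R n.+1).-integrable setT (fun x => (f x)%:E).
Hypothesis mf : measurable_fun setT f.

Lemma integrable_rV_cons : (lebesgue_measure \x lebesgue_rV R n)%E.-integrable
  setT (fun p => (f (rV_cons p))%:E).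
Proof.
have mcons := @measurable_rV_cons R n.
have mfE : measurable_fun setT (fun x => (f x)%:E) by exact/measurable_EFinP.
apply/integrableP; split; first exact: (measurableT_comp mfE mcons).
have /integrableP[_] := intf; congr (_ < _)%E.
have -> : (\int[lebesgue_rV R n.+1]_x `|(f x)%:E| =
  \int[pushforward (lebesgue_measure \x lebesgue_rV R n) (@rV_cons R n)]_x
    `|(f x)%:E|)%E by [].
rewrite ge0_integral_pushforward//.
exact: measurableT_comp.
Qed.

Lemma integral_rV_cons : (\int[lebesgue_rV R n.+1]_x (f x)%:E =
  \int[lebesgue_measure \x lebesgue_rV R n]_p (f (rV_cons p))%:E)%E.
Proof.
have mcons := @measurable_rV_cons R n.
have mfE : measurable_fun setT (fun x => (f x)%:E) by exact/measurable_EFinP.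
have := @integral_pushforward _ _ _ _ R _ mcons
  (lebesgue_measure \x lebesgue_rV R n)%E setT (fun x => (f x)%:E) mfE.
by rewrite preimage_setT => ->//; exact: integrable_rV_cons.
Qed.

Lemma fubini_rV12 : (\int[lebesgue_rV R n.+1]_x (f x)%:E =
  \int[lebesgue_measure]_t \int[lebesgue_rV R n]_v (f (rV_cons (t, v)))%:E)%E.
Proof.
by rewrite integral_rV_cons -(integral12_prod_meas1 integrable_rV_cons).
Qed.

Lemma fubini_rV21 : (\int[lebesgue_rV R n.+1]_x (f x)%:E =
  \int[lebesgue_rV R n]_v \int[lebesgue_measure]_t (f (rV_cons (t, v)))%:E)%E.
Proof.
by rewrite integral_rV_cons -(integral21_prod_meas1 integrable_rV_cons).
Qed.

End fubini.

(** * Integration of partial derivatives *)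

Lemma integral_partial_slice (R : realType) (n : nat) (f : 'rV[R]_n.+1 -> R)
    (M : R) (v : 'rV[R]_n) : elementary f -> 0 < M ->
  (forall t, M < `|t| -> partial ord0 f (rV_cons (t, v)) = 0) ->
  (\int[lebesgue_measure]_t (partial ord0 f (rV_cons (t, v)))%:E =
   (f (rV_cons (M, v)) - f (rV_cons (- M, v)))%:E)%E.
Proof.
move=> ef M0 f0; have [epf _] := elementary_partial ord0 ef.
have cf := @continuous_slice _ _ f v ef.
transitivity (\int[lebesgue_measure]_(t in `[(- M)%R, M])
    (partial ord0 f (rV_cons (t, v)))%:E)%E.
  rewrite [RHS]integral_mkcond; apply: eq_integral => t _.
  rewrite /patch; case: ifPn => //; rewrite notin_setE /= in_itv /= => /negP.
  by rewrite -ler_norml -ltNge => /f0 ->.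
rewrite (@continuous_FTC2 R _ (fun t => f (rV_cons (t, v)))) //; first lra.
- exact/continuous_subspaceT/(@continuous_slice _ _ (partial ord0 f) v epf).
- split.
  + by move=> t _; exact: (@ex_derive _ _ _ _ _ _ _ (is_derive_slice t v ef)).
  + by apply: cvg_at_right_filter; exact: cf.
  + by apply: cvg_at_left_filter; exact: cf.
- move=> t _; rewrite derive1E.
  exact: (@derive_val _ _ _ _ _ _ _ (is_derive_slice t v ef)).
Qed.

(** Fubini and, along the direction of differentiation, the fundamental theorem
    of calculus; the other directions are reached by induction on the dimension
    through the slices. *)
Lemma integral_partial (R : realType) (n : nat) (i : 'I_n) (f : 'rV[R]_n -> R) :
  elementary f -> bounded_support f ->
  \int[lebesgue_rV R n]_x partial i f x = 0.
Proof.
move=> ef bf; rewrite /Rintegral.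
suff -> : (\int[lebesgue_rV R n]_x (partial i f x)%:E = 0)%E by [].
elim: n i f ef bf => [[]//|n IH] i f ef bf.
have [epf _] := elementary_partial i ef.
have bpf := bounded_support_partial i bf.
have intpf := elementary_integrable epf bpf.
have mpf := elementary_measurable epf.
move: bpf intpf mpf; case: (unliftP ord0 i) => [j|] -> bpf intpf mpf.
  rewrite fubini_rV12//; apply: integral0_eq => t _.
  under eq_integral do rewrite partial_slice.
  apply: IH; [exact: elementary_slice|exact: bounded_support_slice].
rewrite fubini_rV21//; apply: integral0_eq => v _.
have [M fM] := bf; have [M' fM'] := bpf.
have M0 : 0 < `|M| + `|M'| + 1 by rewrite ltr_wpDl ?addr_ge0.
have far t : `|M| + `|M'| + 1 <= `|t| -> f (rV_cons (t, v)) = 0.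
  move=> tM; apply/eqP/negPn/negP => /fM/(_ ord0); rewrite rV_cons0.
  by have := ler_norm M; have := normr_ge0 M'; lra.
rewrite (integral_partial_slice ef M0).
  by rewrite (far _ (ler_norm _)) far ?subr0// normrN ler_norm.
move=> t tM; apply/eqP/negPn/negP => /fM'/(_ ord0); rewrite rV_cons0.
by have := ler_norm M'; have := normr_ge0 M; lra.
Qed.

(** Since [f] is constant in [x_1] on either side of the slab, only its jump across
    the slab contributes.  This computes the mass of the source. *)
Lemma integral_partial_step (R : realType) (n : nat) (f : 'rV[R]_n.+1 -> R)
    (G : 'rV[R]_n -> R) (M : R) :
  elementary f -> bounded_support (partial ord0 f) -> 0 < M ->
  (forall t v, M < `|t| -> partial ord0 f (rV_cons (t, v)) = 0) ->
  (forall v, f (rV_cons (M, v)) - f (rV_cons (- M, v)) = G v) ->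
  \int[lebesgue_rV R n.+1]_x partial ord0 f x = \int[lebesgue_rV R n]_v G v.
Proof.
move=> ef bpf M0 far fG; have [epf _] := elementary_partial ord0 ef.
rewrite /Rintegral fubini_rV21//; last 2 first.
- exact: elementary_integrable.
- exact: elementary_measurable.
congr fine; apply: eq_integral => v _.
by rewrite (integral_partial_slice ef M0) ?fG// => t; exact: far.
Qed.

(** * The corrector equation tested against a cutoff *)

Lemma Rintegral_sum (d : measure_display) (T : measurableType d) (R : realType)
    (mu : {measure set T -> \bar R}) (I : Type) (s : seq I) (F : I -> T -> R) :
  (forall i, mu.-integrable setT (fun x => (F i x)%:E)) ->
  \int[mu]_x (\sum_(i <- s) F i x) = \sum_(i <- s) \int[mu]_x F i x.
Proof.
move=> intF; rewrite /Rintegral.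
under eq_integral do rewrite -sumEFin.
rewrite integral_sum//.
rewrite (_ : (\sum_(i <- s) _)%E =
    (\sum_(i <- s) \int[mu]_x F i x)%:E) // -sumEFin.
by apply: eq_bigr => i _; rewrite fineK// integrable_fin_num.
Qed.

Lemma bounded_supportM (R : realType) (n : nat) (f g : 'rV[R]_n -> R) :
  bounded_support g -> bounded_support (fun x => f x * g x).
Proof.
move=> [M gM]; exists M => x fgx; apply: gM.
by apply: contraNneq fgx => ->; rewrite mulr0.
Qed.

Lemma bounded_supportD (R : realType) (n : nat) (f g : 'rV[R]_n -> R) :
  bounded_support f -> bounded_support g ->
  bounded_support (fun x => f x + g x).
Proof.
move=> [M fM] [N gN]; exists (`|M| + `|N|) => x fgx i.
have [f0|/fM/(_ i)] := eqVneq (f x) 0; last first.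
  by have := ler_norm M; have := normr_ge0 N; lra.
have : g x != 0 by apply: contraNneq fgx => ->; rewrite f0 addr0.
by move=> /gN/(_ i); have := ler_norm N; have := normr_ge0 M; lra.
Qed.

Lemma bounded_support_sum (R : realType) (n : nat) (I : Type) (s : seq I)
    (F : I -> 'rV[R]_n -> R) : (forall i, bounded_support (F i)) ->
  bounded_support (fun x => \sum_(i <- s) F i x).
Proof.
move=> bF; elim: s => [|i s IH].
  by exists 0 => x; rewrite big_nil eqxx.
by under eq_fun do rewrite big_cons; exact: bounded_supportD.
Qed.

Section weak_formulation.
Context {R : realType} {d : nat} (hd : (3 <= d)%N) (eta1 eta2 : R -> R).
Hypotheses (smooth1 : smooth_R eta1) (smooth2 : smooth_R eta2).

Local Notation leb := (lebesgue_rV R d).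
Local Notation i1 := (Ordinal (ltnW (ltnW hd))).
Local Notation i2 := (Ordinal (ltnW hd)).
Local Notation eta := (Defs.eta hd eta1 eta2).
Implicit Types (f psi : 'rV[R]_d -> R).

Lemma dot_ebasis (x : 'rV[R]_d) i : dot x (ebasis i) = x 0 i.
Proof.
rewrite /dot (bigD1 i)//= mxE !eqxx mulr1 big1 ?addr0// => j ji.
by rewrite mxE (negbTE ji) andbF mulr0.
Qed.

Lemma etaE x : eta x = eta1 (x 0 i1) * eta2 (x 0 i2).
Proof. by rewrite /Defs.eta !dot_ebasis. Qed.

Lemma elementary_eta : elementary eta.
Proof.
have -> : eta = (fun x => eta1 (x 0 i1) * eta2 (x 0 i2)).
  by apply/funext => x; rewrite etaE.
by apply: elementaryM; apply: elementary_comp => //; exact: elementary_coord.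
Qed.

(** [div (a grad psi)] in expanded form. *)
Definition corrector_operator psi (x : 'rV[R]_d) : R :=
  \sum_i partial i (partial i psi) x +
  partial i1 (fun y => eta y * partial i1 psi y) x.

Lemma acoefE (x v : 'rV[R]_d) i :
  (v *m (acoef hd eta1 eta2 x)^T) 0 i = v 0 i + (i == i1)%:R * eta x * v 0 i1.
Proof.
rewrite /acoef linearD /= trmx1 mulmxDr mulmx1 mxE; congr (_ + _).
rewrite linearZ /= -scalemxAr mxE trmx_mul trmxK mulmxA mxE big_ord1.
have -> : (v *m (e_1 hd)^T) 0 0 = v 0 i1.
  by rewrite -dot_ebasis mxE; apply: eq_bigr => k _; rewrite mxE.
by rewrite !mxE eqxx /= eq_sym; ring.
Qed.

Section test.
Variable psi : 'rV[R]_d -> R.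
Hypotheses (epsi : elementary psi) (bpsi : bounded_support psi).

Let epart i : elementary (partial i psi).
Proof. by have [] := elementary_partial i epsi. Qed.

Let bpart i : bounded_support (partial i psi).
Proof. exact: bounded_support_partial. Qed.

Let eflux : elementary (fun y => eta y * partial i1 psi y).
Proof. by apply: elementaryM => //; exact: elementary_eta. Qed.

Let bflux : bounded_support (fun y => eta y * partial i1 psi y).
Proof. exact: bounded_supportM. Qed.

(** The weak gradient of [f] is integrated by parts twice: against [d_i psi] and
    against [eta d_1 psi], both test functions. *)
Lemma integral_corrector_operator f :
  corrector (acoef hd eta1 eta2) i1 f ->
  \int[leb]_x (f x * corrector_operator psi x) =
  \int[leb]_x (eta x * partial i1 psi x).
Proof.
move=> [g [f2 g2 wg] /(_ psi (elementary_test_function epsi bpsi))].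
have epp i : elementary (partial i (partial i psi)).
  by have [] := elementary_partial i (epart i).
have bpp i := bounded_support_partial i (bpart i).
have [epf _] := elementary_partial i1 eflux.
have bpf := bounded_support_partial i1 bflux.
have int1 i := L2locM_integrable f2 (epp i) (bpp i).
have int2 := L2locM_integrable f2 epf bpf.
have int3 i := L2locM_integrable (g2 i) (epart i) (bpart i).
have int4 := L2locM_integrable (g2 i1) eflux bflux.
have int5 := elementary_integrable (epart i1) (bpart i1).
have int6 := elementary_integrable eflux bflux.
have -> : (fun x => dot ((ebasis i1 + g x) *m (acoef hd eta1 eta2 x)^T)
    (grad psi x)) = (fun x => (\sum_i g x 0 i * partial i psi x
     + g x 0 i1 * (eta x * partial i1 psi x))
     + (partial i1 psi x + eta x * partial i1 psi x)).
  apply/funext => x; rewrite /dot.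
  under eq_bigr do rewrite acoefE mxE [X in _ * X]mxE.
  rewrite (eq_bigr (fun i => g x 0 i * partial i psi x +
    (i == i1)%:R * ((1 + eta x) * partial i1 psi x +
       g x 0 i1 * (eta x * partial i1 psi x)))) => [|i _]; last first.
    rewrite !mxE !eqxx /=; have [->|ii1] := eqVneq i i1; rewrite /=; ring.
  rewrite big_split /= -addrA; congr (_ + _).
  rewrite (bigD1 i1)//= ?eqxx mul1r big1 ?addr0 => [|i /negbTE ->]; last first.
    by rewrite mul0r.
  ring.
have intD (u v : 'rV[R]_d -> R) : leb.-integrable setT (fun x => (u x)%:E) ->
    leb.-integrable setT (fun x => (v x)%:E) ->
    leb.-integrable setT (fun x => (u x + v x)%:E).
  by move=> iu iv; have := integrableD measurableT iu iv.
have intS (F : 'I_d -> 'rV[R]_d -> R) :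
    (forall i, leb.-integrable setT (fun x => (F i x)%:E)) ->
    leb.-integrable setT (fun x => (\sum_i F i x)%:E).
  move=> iF; have -> : (fun x => (\sum_i F i x)%:E) =
      (fun x => \sum_(i <- index_enum 'I_d) (F i x)%:E)%E.
    by apply/funext => x; rewrite -sumEFin.
  exact: integrable_sum.
rewrite RintegralD//; [|by apply: intD => //; exact: intS|exact: intD].
rewrite RintegralD//.
rewrite RintegralD//; last exact: intS.
rewrite (integral_partial i1 epsi bpsi) add0r Rintegral_sum//.
have -> : (fun x => f x * corrector_operator psi x) =
   (fun x => \sum_i f x * partial i (partial i psi) x
     + f x * partial i1 (fun y => eta y * partial i1 psi y) x).
  by apply/funext => x; rewrite /corrector_operator mulrDr mulr_sumr.
rewrite RintegralD//; last exact: intS.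
rewrite Rintegral_sum//.
have solve (A B C X Y : R) : X = - A -> Y = - B -> A + B + C = 0 -> X + Y = C.
  by move=> -> ->; lra.
apply: solve; last exact: wg i1 _ (elementary_test_function eflux bflux).
rewrite -sumrN; apply: eq_bigr => i _.
by apply: wg; exact: elementary_test_function.
Qed.

(** Constants are invisible because the operator is a divergence; the right-hand
    side is rewritten by integrating [d_1 (eta psi)], so that the source
    [d_1 eta] appears. *)
Lemma integral_corrector_operator_center f (c : R) :
  corrector (acoef hd eta1 eta2) i1 f ->
  leb.-integrable setT (fun x => ((f x - c) * corrector_operator psi x)%:E) /\
  \int[leb]_x ((f x - c) * corrector_operator psi x) =
  - \int[leb]_x (partial i1 eta x * psi x).
Proof.
move=> cf; have E := integral_corrector_operator cf.
have [g [f2 _ _] _] := cf.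
have eop : elementary (corrector_operator psi).
  apply: elementaryD; last by have [] := elementary_partial i1 eflux.
  by apply: elementary_sum => i _; have [] := elementary_partial i (epart i).
have bop : bounded_support (corrector_operator psi).
  apply: bounded_supportD; last exact: bounded_support_partial.
  by apply: bounded_support_sum => i; exact: bounded_support_partial.
have int1 := L2locM_integrable f2 eop bop.
have int2 := elementary_integrable eop bop.
have epp i : elementary (partial i (partial i psi)).
  by have [] := elementary_partial i (epart i).
have [epf _] := elementary_partial i1 eflux.
have int_op : \int[leb]_x corrector_operator psi x = 0.
  rewrite /corrector_operator RintegralD//; last 2 first.
  - apply: elementary_integrable; first by apply: elementary_sum.
    by apply: bounded_support_sum => i; exact: bounded_support_partial.
  - by apply: elementary_integrable => //; exact: bounded_support_partial.
  rewrite (integral_partial i1 eflux bflux) addr0 Rintegral_sum => [|i].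
    by rewrite big1// => i _; exact: integral_partial (epart i) (bpart i).
  by apply: elementary_integrable => //; exact: bounded_support_partial.
have int3 : leb.-integrable setT (fun x => (c * corrector_operator psi x)%:E).
  by have := integrableZl measurableT c int2.
have int4 := integrableB measurableT int1 int3.
split; first by under eq_fun do rewrite mulrBl EFinB.
under eq_Rintegral do rewrite mulrBl.
rewrite RintegralB// E RintegralZl// int_op mulr0 subr0.
have [eeta deta] := elementary_partial i1 elementary_eta.
have [_ dpsi] := elementary_partial i1 epsi.
have epsieta : elementary (fun x => eta x * psi x).
  by apply: elementaryM => //; exact: elementary_eta.
have := integral_partial i1 epsieta (bounded_supportM (eta) bpsi).
have -> : partial i1 (fun x => eta x * psi x) =
    (fun x => eta x * partial i1 psi x + partial i1 eta x * psi x).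
  apply: partial_val => x; rewrite [X in _ + X]mulrC.
  by apply: is_deriveM; apply: derivableP.
rewrite RintegralD//; last 2 first.
- by apply: elementary_integrable => //; exact: bounded_supportM.
- by apply: elementary_integrable; [exact: elementaryM|exact: bounded_supportM].
by move=> /eqP; rewrite addr_eq0 => /eqP.
Qed.

End test.
End weak_formulation.

(** * The logarithmic cutoff and its derivatives *)

Lemma derive1_locally_cst (R : realType) (f : R -> R) (c t : R) :
  (\forall s \near t, f s = c) -> derive1 f t = 0.
Proof.
by move=> fc; rewrite derive1E (@near_eq_derive _ _ _ f (cst c)) ?derive_cst.
Qed.

Lemma near_norm_gt (R : realType) (a t : R) : a < `|t| ->
  \forall s \near t, a < `|s|.
Proof.
move=> at_; have ct : `|s| @[s --> t] --> `|t| by apply: cvg_norm; exact: cvg_id.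
exact: cvgr_gt ct _ at_.
Qed.

Lemma near_norm_lt (R : realType) (a t : R) : `|t| < a ->
  \forall s \near t, `|s| < a.
Proof.
move=> at_; have ct : `|s| @[s --> t] --> `|t| by apply: cvg_norm; exact: cvg_id.
exact: cvgr_lt ct _ at_.
Qed.

(** The extreme value theorem for [f ^ 2] on the segment. *)
Lemma bounded_of_support (R : realType) (f : R -> R) (a : R) : 0 < a ->
  continuous f -> (forall t, a < `|t| -> f t = 0) ->
  exists2 K : R, 0 < K & forall t, `|f t| <= K.
Proof.
move=> a0 cf fa; pose g t := f t * f t.
have cg : continuous g by move=> t; exact: (continuousM (cf t) (cf t)).
have g0 t : 0 <= g t by rewrite /g -expr2 sqr_ge0.
have [|c _ cmax] := @EVT_max R g (- a) a _ (continuous_subspaceT cg); first lra.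
exists (g c + 1) => [|t]; first by rewrite ltr_wpDl.
case: (ltP a `|t|) => [/fa ->|ta]; first by rewrite normr0 addr_ge0.
apply: (@le_trans _ _ (g t + 1)).
  by rewrite /g -expr2 -real_normK ?num_real//; nra.
by rewrite lerD2r; apply: cmax; rewrite in_itv /= -ler_norml.
Qed.

Lemma smooth_R_chain (R : realType) (V : normedModType R) (f : V -> R)
    (h : R -> R) (x v : V) (df : R) : smooth_R h ->
  is_derive x v f df ->
  is_derive x v (fun y => h (f y)) (derive1 h (f x) * df).
Proof. by move=> sh fd; apply: is_derive_chain fd _; exact: smooth_R_is_derive. Qed.

Lemma is_derive_cmul (R : realType) (V : normedModType R) (f : V -> R) (c : R)
    (x v : V) (df : R) :
  is_derive x v f df -> is_derive x v (fun y => c * f y) (c * df).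
Proof. by move=> fd; exact: is_deriveZ. Qed.

Lemma is_derive_mul (R : realType) (V : normedModType R) (f g : V -> R)
    (x v : V) (df dg : R) :
  is_derive x v f df -> is_derive x v g dg ->
  is_derive x v (fun y => f y * g y) (f x * dg + g x * df).
Proof. by move=> fd gd; exact: is_deriveM. Qed.

Section log_cutoff.
Context {R : realType} {d : nat} (hd : (3 <= d)%N) (h : R -> R).
Hypothesis sh : smooth_R h.
Variables L rho : R.

Local Notation i1 := (Ordinal (ltnW (ltnW hd))).
Local Notation i2 := (Ordinal (ltnW hd)).
Implicit Type x : 'rV[R]_d.

Definition horizontal (j : 'I_d) := (j == i1) || (j == i2).

(** The square of the Japanese bracket of [(x_1, x_2)]; its logarithm is smooth
    on the whole space, unlike that of the Euclidean norm. *)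
Definition bracket_sq x : R := 1 + (x 0 i1 * x 0 i1 + x 0 i2 * x 0 i2).

Definition tail_sq x : R := \sum_(i | ~~ horizontal i) x 0 i * x 0 i.

(** The second parameter is a squared length. *)
Definition log_cutoff x : R :=
  h (L^-1 * ln (bracket_sq x)) * h (rho^-1 * tail_sq x).

Local Notation u := bracket_sq.
Local Notation q := tail_sq.
Local Notation A := (fun x => h (L^-1 * ln (u x))).
Local Notation A1 := (fun x => derive1 h (L^-1 * ln (u x))).
Local Notation A2 := (fun x => derive1 (derive1 h) (L^-1 * ln (u x))).
Local Notation B := (fun x => h (rho^-1 * q x)).
Local Notation B1 := (fun x => derive1 h (rho^-1 * q x)).
Local Notation B2 := (fun x => derive1 (derive1 h) (rho^-1 * q x)).

Lemma bracket_sq_ge1 x : 1 <= u x.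
Proof. by rewrite /bracket_sq lerDl addr_ge0// -expr2 sqr_ge0. Qed.

Lemma bracket_sq_gt0 x : 0 < u x.
Proof. exact: lt_le_trans ltr01 (bracket_sq_ge1 x). Qed.

Lemma i2_neq_i1 : (i2 == i1) = false. Proof. by []. Qed.

Lemma elementary_bracket_sq : elementary u.
Proof.
apply: elementaryD; first exact: elementary_cst.
by apply: elementaryD; apply: elementaryM; exact: elementary_coord.
Qed.

Lemma elementary_log_cutoff : elementary log_cutoff.
Proof.
apply: elementaryM; apply: elementary_comp => //.
  apply: elementaryM; first exact: elementary_cst.
  by apply: elementary_ln; [exact: bracket_sq_gt0|exact: elementary_bracket_sq].
apply: elementaryM; first exact: elementary_cst.
apply: elementary_sum => i _.
by apply: elementaryM; exact: elementary_coord.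
Qed.

Let is_derive_coord_sqr i j x :
  is_derive x (ebasis j) (fun y : 'rV[R]_d => y 0 i * y 0 i)
    ((i == j)%:R * (2 * x 0 i)).
Proof.
have di := is_derive_coord i j x.
by apply: is_derive_eq (is_derive_mul di di) _; ring.
Qed.

Lemma is_derive_bracket_sq j x :
  is_derive x (ebasis j) u ((horizontal j)%:R * (2 * x 0 j)).
Proof.
have := is_deriveD (is_derive_cst (1 : R) x (ebasis j))
  (is_deriveD (is_derive_coord_sqr i1 j x) (is_derive_coord_sqr i2 j x)).
move/is_derive_eq; apply; rewrite add0r /horizontal (eq_sym j i1) (eq_sym j i2).
have [<-|] := eqVneq i1 j; first by rewrite i2_neq_i1 mul0r addr0.
by move=> _; have [->|] := eqVneq i2 j; rewrite !mul0r add0r.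
Qed.

Lemma is_derive_tail_sq j x :
  is_derive x (ebasis j) q ((~~ horizontal j)%:R * (2 * x 0 j)).
Proof.
have qE : q = \sum_(i < d) (fun y : 'rV[R]_d => (~~ horizontal i)%:R * (y 0 i * y 0 i)).
  apply/funext => y; rewrite /tail_sq fct_sumE big_mkcond /=.
  by apply: eq_bigr => i _; case: (horizontal i); rewrite /= ?mul0r ?mul1r.
rewrite qE; have := @is_derive_sum R _ _ d
  (fun i (y : 'rV[R]_d) => (~~ horizontal i)%:R * (y 0 i * y 0 i)) x (ebasis j)
  (fun i => (~~ horizontal i)%:R * ((i == j)%:R * (2 * x 0 i))).
move=> /(_ _)/is_derive_eq; apply; last first.
  rewrite (bigD1 j)//= eqxx mul1r big1 ?addr0// => i /negbTE ->.
  by rewrite mul0r mulr0.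
move=> i; have := is_derive_cmul (~~ horizontal i)%:R
  (is_derive_coord_sqr i j x).
exact.
Qed.

Lemma is_derive_horizontal_factor (k : R -> R) j x : smooth_R k ->
  is_derive x (ebasis j) (fun y => k (L^-1 * ln (u y)))
    (derive1 k (L^-1 * ln (u x)) *
      (L^-1 * ((u x)^-1 * ((horizontal j)%:R * (2 * x 0 j))))).
Proof.
move=> sk; apply: (smooth_R_chain sk).
have := is_derive_cmul L^-1
  (is_derive_ln (bracket_sq_gt0 x) (is_derive_bracket_sq j x)).
exact.
Qed.

Lemma is_derive_tail_factor (k : R -> R) j x : smooth_R k ->
  is_derive x (ebasis j) (fun y => k (rho^-1 * q y))
    (derive1 k (rho^-1 * q x) *
      (rho^-1 * ((~~ horizontal j)%:R * (2 * x 0 j)))).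
Proof.
move=> sk; apply: (smooth_R_chain sk).
have := is_derive_cmul rho^-1 (is_derive_tail_sq j x).
exact.
Qed.

Lemma partial_log_cutoff_horizontal j : horizontal j ->
  partial j log_cutoff =
  (fun x => A1 x * B x * (L^-1 * (2 * x 0 j * (u x)^-1))).
Proof.
move=> hj; apply: partial_val => x.
have := is_derive_mul (is_derive_horizontal_factor j x sh)
  (is_derive_tail_factor j x sh).
by move/is_derive_eq; apply; rewrite hj /=; ring.
Qed.

Lemma partial2_log_cutoff_horizontal j x : horizontal j ->
  partial j (partial j log_cutoff) x =
  B x * (A2 x * (L^-1 * (2 * x 0 j * (u x)^-1)) ^+ 2 +
    A1 x * (L^-1 * (2 * (u x)^-1 - (2 * x 0 j * (u x)^-1) ^+ 2))).
Proof.
move=> hj; rewrite partial_log_cutoff_horizontal//.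
have sh1 := smooth_R_derive1 sh.
apply: partial_at.
have dcoef := is_derive_mul
  (is_derive_cmul 2 (is_derive_coord j j x))
  (is_derive_inv (bracket_sq_gt0 x) (is_derive_bracket_sq j x)).
have := is_derive_mul
  (is_derive_mul (is_derive_horizontal_factor j x sh1)
    (is_derive_tail_factor j x sh)) (is_derive_cmul L^-1 dcoef).
by move/is_derive_eq; apply; rewrite hj eqxx /=; ring.
Qed.

Lemma partial2_log_cutoff_tail j x : ~~ horizontal j ->
  partial j (partial j log_cutoff) x =
  A x * (B2 x * (rho^-1 * (2 * x 0 j)) ^+ 2 + B1 x * (rho^-1 * 2)).
Proof.
move=> hj; have sh1 := smooth_R_derive1 sh.
have -> : partial j log_cutoff = (fun x => A x * B1 x * (rho^-1 * (2 * x 0 j))).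
  apply: partial_val => {}x.
  have := is_derive_mul (is_derive_horizontal_factor j x sh)
    (is_derive_tail_factor j x sh).
  by move/is_derive_eq; apply; rewrite hj (negbTE hj) /=; ring.
apply: partial_at.
have dcoef := is_derive_cmul rho^-1
  (is_derive_cmul 2 (is_derive_coord j j x)).
have := is_derive_mul
  (is_derive_mul (is_derive_horizontal_factor j x sh)
    (is_derive_tail_factor j x sh1)) dcoef.
by move/is_derive_eq; apply; rewrite hj (negbTE hj) eqxx /=; ring.
Qed.

End log_cutoff.

(** * Pointwise estimate of the operator *)

Lemma norm_mul_le (R : realType) (a b M N : R) :
  `|a| <= M -> `|b| <= N -> `|a * b| <= M * N.
Proof. by move=> aM bN; rewrite normrM ler_pM. Qed.

Section operator_bounds.
Context {R : realType} {d : nat} (hd : (3 <= d)%N) (eta1 eta2 : R -> R).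
Hypotheses (smooth1 : smooth_R eta1) (smooth2 : smooth_R eta2).
Hypotheses (range1 : forall t, 0 <= eta1 t <= 1)
  (range2 : forall t, 0 <= eta2 t <= 1).
Hypothesis flat1 : forall t, t < 0 \/ 1 < t -> derive1 eta1 t = 0.
Hypothesis out2 : forall t, 1 < `|t| -> eta2 t = 0.
Hypothesis in2 : forall t, `|t| <= 1 / 2 -> eta2 t = 1.
Variable M : R.
Hypothesis M1 : forall t, `|derive1 eta2 t| <= M.
Hypothesis M2 : forall t, `|derive1 (derive1 eta2) t| <= M.
Variables L rho : R.
Hypotheses (L1 : 1 <= L) (rho0 : 0 < rho) (L3 : ln 3 < L / 2).

Local Notation i1 := (Ordinal (ltnW (ltnW hd))).
Local Notation i2 := (Ordinal (ltnW hd)).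
Local Notation eta := (Defs.eta hd eta1 eta2).
Local Notation psi := (log_cutoff hd eta2 L (rho ^+ 2)).
Local Notation op := (corrector_operator hd eta1 eta2 psi).
Local Notation u := (bracket_sq hd).
Local Notation q := (tail_sq hd).
Local Notation hor := (horizontal hd).
Local Notation A x := (eta2 (L^-1 * ln (u x))).
Local Notation A1 x := (derive1 eta2 (L^-1 * ln (u x))).
Local Notation A2 x := (derive1 (derive1 eta2) (L^-1 * ln (u x))).
Local Notation B x := (eta2 ((rho ^+ 2)^-1 * q x)).
Local Notation B1 x := (derive1 eta2 ((rho ^+ 2)^-1 * q x)).
Local Notation B2 x := (derive1 (derive1 eta2) ((rho ^+ 2)^-1 * q x)).
Implicit Type x : 'rV[R]_d.

Lemma out2_derive t : 1 < `|t| -> derive1 eta2 t = 0.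
Proof.
move=> t1; apply: (@derive1_locally_cst _ _ 0).
by apply: filterS (near_norm_gt t1) => s; exact: out2.
Qed.

Lemma out2_derive2 t : 1 < `|t| -> derive1 (derive1 eta2) t = 0.
Proof.
move=> t1; apply: (@derive1_locally_cst _ _ 0).
by apply: filterS (near_norm_gt t1) => s; exact: out2_derive.
Qed.

Lemma in2_derive t : `|t| < 1 / 2 -> derive1 eta2 t = 0.
Proof.
move=> t1; apply: (@derive1_locally_cst _ _ 1).
by apply: filterS (near_norm_lt t1) => s /ltW; exact: in2.
Qed.

Lemma partial_eta x :
  partial i1 eta x = derive1 eta1 (x 0 i1) * eta2 (x 0 i2).
Proof.
have -> : eta = (fun x => eta1 (x 0 i1) * eta2 (x 0 i2)).
  by apply/funext => y; rewrite etaE.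
apply: partial_at.
have := is_derive_mul (smooth_R_chain smooth1 (is_derive_coord i1 i1 x))
  (smooth_R_chain smooth2 (is_derive_coord i2 i1 x)).
by move/is_derive_eq; apply; rewrite eqxx (i2_neq_i1 hd) /=; ring.
Qed.

Lemma partial_flux x :
  partial i1 (fun y => eta y * partial i1 psi y) x =
  eta x * partial i1 (partial i1 psi) x + partial i1 eta x * partial i1 psi x.
Proof.
have epsi := elementary_log_cutoff hd smooth2 L (rho ^+ 2).
have [_ deta] := elementary_partial i1 (elementary_eta hd smooth1 smooth2).
have [epart _] := elementary_partial i1 epsi.
have [_ dpart] := elementary_partial i1 epart.
apply: partial_at.
have := is_derive_mul (derivableP (deta x)) (derivableP (dpart x)).
by move/is_derive_eq; apply; rewrite /partial; ring.
Qed.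

Lemma hor1 : hor i1. Proof. by rewrite /horizontal eqxx. Qed.
Lemma hor2 : hor i2. Proof. by rewrite /horizontal eqxx orbT. Qed.

Lemma sum_split_horizontal (F : 'I_d -> R) :
  \sum_i F i = F i1 + F i2 + \sum_(i | ~~ hor i) F i.
Proof.
rewrite (bigD1 i1)//= (bigD1 i2)//= addrA; congr (_ + _).
by apply: eq_bigl => i; rewrite /horizontal negb_or.
Qed.

(** In the sum of the two horizontal second derivatives, the terms of order
    [v / L] reduce to [4 v ^ 2 / L] because [(x_1^2 + x_2^2) v = 1 - v]: this is
    the harmonicity of the logarithm in dimension two, without which the
    integral of the first line would not decay as [L] grows. *)
Lemma operatorE x : let a := x 0 i1 in let v := (u x)^-1 in
  op x =
  B x * (A2 x * (L^-1) ^+ 2 * (4 * (v - v ^+ 2)) + A1 x * L^-1 * (4 * v ^+ 2))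
  + \sum_(i | ~~ hor i) A x * (B2 x * ((rho ^+ 2)^-1 * (2 * x 0 i)) ^+ 2
      + B1 x * ((rho ^+ 2)^-1 * 2))
  + eta x * (B x * (A2 x * (L^-1) ^+ 2 * (2 * a * v) ^+ 2 +
      A1 x * L^-1 * (2 * v - (2 * a * v) ^+ 2)))
  + derive1 eta1 a * eta2 (x 0 i2) * (A1 x * B x * (L^-1 * (2 * a * v))).
Proof.
move=> a v; rewrite /corrector_operator partial_flux sum_split_horizontal.
rewrite !partial2_log_cutoff_horizontal ?hor1 ?hor2//.
rewrite partial_log_cutoff_horizontal ?hor1// partial_eta -!addrA.
rewrite -/a -/v addrA; congr (_ + (_ + _)).
- have uv : (1 + (a * a + x 0 i2 * x 0 i2)) * v = 1.
    by rewrite /v mulfV// gt_eqF// bracket_sq_gt0.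
  have -> : v - v ^+ 2 = (a * a + x 0 i2 * x 0 i2) * v ^+ 2.
    rewrite -[X in X - _]mul1r -uv; ring.
  have -> : 4 * v ^+ 2 = 4 * v - 4 * ((a * a + x 0 i2 * x 0 i2) * v ^+ 2).
    rewrite -[X in 4 * X - _]mul1r -uv; ring.
  ring.
- by apply: eq_bigr => i ti; exact: partial2_log_cutoff_tail.
- ring.
Qed.

Lemma tail_sq_ge0 x : 0 <= q x.
Proof. by apply: sumr_ge0 => i _; rewrite -expr2 sqr_ge0. Qed.

Let L0 : 0 < L. Proof. exact: lt_le_trans ltr01 L1. Qed.
Let r0 : 0 < rho ^+ 2. Proof. by rewrite exprn_gt0. Qed.

Lemma horizontal_factor_out x : L < ln (u x) -> 1 < `|L^-1 * ln (u x)|.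
Proof.
move=> big; rewrite ger0_norm; first by rewrite mulrC ltr_pdivlMr ?mul1r.
by rewrite mulr_ge0 ?invr_ge0 ?(ltW L0)// ltW// (lt_trans L0).
Qed.

Lemma tail_factor_out x : rho ^+ 2 < q x -> 1 < `|(rho ^+ 2)^-1 * q x|.
Proof.
move=> big; rewrite ger0_norm; first by rewrite mulrC ltr_pdivlMr ?mul1r.
by rewrite mulr_ge0 ?invr_ge0 ?(ltW r0)// ltW// (lt_trans r0).
Qed.

Lemma log_cutoff_support x : psi x != 0 -> ln (u x) <= L /\ q x <= rho ^+ 2.
Proof.
move=> psi0; split; rewrite leNgt; apply: contraNN psi0 => big.
  by rewrite /log_cutoff (out2 (horizontal_factor_out big)) mul0r.
by rewrite /log_cutoff (out2 (tail_factor_out big)) mulr0.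
Qed.

Lemma operator_support x : op x != 0 -> ln (u x) <= L /\ q x <= rho ^+ 2.
Proof.
move=> op0; split; rewrite leNgt; apply: contraNN op0 => big; rewrite operatorE.
  have b := horizontal_factor_out big.
  rewrite big1 => [|i _]; last by rewrite (out2 b) mul0r.
  by rewrite out2_derive// out2_derive2// !(mul0r, mulr0, addr0).
have b := tail_factor_out big; rewrite (out2 b) big1 => [|i _]; last first.
  by rewrite out2_derive2// out2_derive// !mul0r addr0 mulr0.
by rewrite !(mul0r, mulr0, addr0).
Qed.

(** The source lies in [x_1^2 + x_2^2 <= 2], where the logarithmic factor is
    still on its plateau. *)
Lemma log_factor_near_origin x : 0 <= x 0 i1 -> x 0 i1 <= 1 ->
  `|x 0 i2| <= 1 -> `|L^-1 * ln (u x)| < 1 / 2.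
Proof.
set a := x 0 i1; set b := x 0 i2 => a0 a1 b1.
have l0 : 0 < L^-1 by rewrite invr_gt0.
rewrite ger0_norm; last first.
  by apply: mulr_ge0; [exact: ltW|apply: ln_ge0; exact: bracket_sq_ge1].
rewrite mulrC ltr_pdivrMr//.
have lt3 : ln 3 < 1 / 2 * L by rewrite mulrC mulrA mulr1.
apply: le_lt_trans lt3.
rewrite ler_ln ?posrE ?bracket_sq_gt0// /bracket_sq -/a -/b.
by have : `|b| ^+ 2 <= 1 ^+ 2; [rewrite lerXn2r// nnegrE|
  rewrite real_normK ?num_real// expr1n expr2; nra].
Qed.

(** The first two terms are the almost harmonic logarithm, the third one is the
    cutoff in the remaining directions, the last one the strip where [eta] does
    not vanish; the product of gradients [d_1 eta d_1 psi] is zero since [psi]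
    is locally constant in [(x_1, x_2)] on the source. *)
Lemma operator_bound x : q x <= rho ^+ 2 ->
  `|op x| <= M * (4 * (L^-1) ^+ 2 * (u x)^-1 + 4 * L^-1 * (u x)^-1 ^+ 2
     + (6 * (rho ^+ 2)^-1) *+ d
     + ((`|x 0 i2| <= 1)%R)%:R * (10 * L^-1 * (u x)^-1)).
Proof.
move=> qx; rewrite operatorE; set a := x 0 i1; set b := x 0 i2.
set v := (u x)^-1; set l := L^-1.
have v0 : 0 < v by rewrite invr_gt0 bracket_sq_gt0.
have v1 : v <= 1 by rewrite invf_le1 ?bracket_sq_gt0 ?bracket_sq_ge1.
have l0 : 0 < l by rewrite invr_gt0.
have l1 : l <= 1 by rewrite invf_le1.
have M0 : 0 <= M := le_trans (normr_ge0 _) (M1 0).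
have n2 t : `|eta2 t| <= 1 by have /andP[t0 t1] := range2 t; rewrite ger0_norm.
have uv : (1 + (a * a + b * b)) * v = 1.
  by rewrite /v mulfV// gt_eqF// bracket_sq_gt0.
have av2 : (2 * a * v) ^+ 2 <= 4 * v.
  have E : (2 * a * v) ^+ 2 + 4 * v * ((1 + b * b) * v) = 4 * v * 1.
    by transitivity (4 * v * ((1 + (a * a + b * b)) * v)); [ring|rewrite uv].
  have : 0 <= 4 * v * ((1 + b * b) * v).
    have := sqr_ge0 b; rewrite expr2 => b0.
    by rewrite !mulr_ge0// ltW// ltr_pwDl.
  by move=> p; rewrite mulr1 in E; lra.
have -> : M * (4 * l ^+ 2 * v + 4 * l * v ^+ 2 + (6 * (rho ^+ 2)^-1) *+ d
    + ((`|b| <= 1)%R)%:R * (10 * l * v)) =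
  1 * (M * l ^+ 2 * (4 * v) + M * l * (4 * v ^+ 2))
  + M * (6 * (rho ^+ 2)^-1) *+ d
  + ((`|b| <= 1)%R)%:R * (1 * (M * l * (4 * v) + M * l * (6 * v))) + 0.
  rewrite -(mulrnAr M); set D := _ *+ d; set c := ((_ <= _)%R)%:R; ring.
have lv : 0 <= l ^+ 2 by rewrite sqr_ge0.
apply: le_trans (ler_normD _ _) _; apply: lerD; last first.
  (* Where [eta1] varies and [eta2] is nonzero, the cutoff is locally constant. *)
  rewrite normr_le0; have [b1|b1] := lerP `|b| 1; last first.
    by rewrite (out2 b1) mulr0 mul0r.
  have [a0|a0] := ltP a 0; first by rewrite flat1 ?mul0r//; left.
  have [a1|a1] := ltP 1 a; first by rewrite flat1 ?mul0r//; right.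
  by rewrite in2_derive ?log_factor_near_origin// !mul0r mulr0.
apply: le_trans (ler_normD _ _) _; apply: lerD; last first.
  rewrite etaE -/a -/b; have [b1|b1] := lerP `|b| 1; last first.
    by rewrite (out2 b1) mulr0 !mul0r normr0.
  rewrite mul1r -[leRHS]mul1r; apply: norm_mul_le.
    have /andP[? ?] := range1 a; have := n2 b.
    by rewrite normrM => ?; rewrite mulr_ile1// ger0_norm.
  apply: norm_mul_le => //; apply: le_trans (ler_normD _ _) _; apply: lerD.
    apply: norm_mul_le; last by rewrite ger0_norm ?sqr_ge0.
    by apply: norm_mul_le => //; rewrite ger0_norm//; nra.
  apply: norm_mul_le.
    by apply: norm_mul_le => //; rewrite ger0_norm// ltW.
  have := sqr_ge0 (2 * a * v); rewrite ler_norml; lra.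
apply: le_trans (ler_normD _ _) _; apply: lerD.
  apply: norm_mul_le => //; apply: le_trans (ler_normD _ _) _; apply: lerD.
    apply: norm_mul_le; last by rewrite ger0_norm; nra.
    by apply: norm_mul_le => //; rewrite ger0_norm.
  apply: norm_mul_le; last by rewrite ger0_norm// mulr_ge0// sqr_ge0.
  by apply: norm_mul_le => //; rewrite ger0_norm// ltW.
apply: le_trans (ler_norm_sum _ _ _) _.
apply: (@le_trans _ _ (\sum_(i < d) M * (6 * (rho ^+ 2)^-1))); last first.
  by rewrite sumr_const card_ord.
rewrite [leRHS](bigID (fun i => ~~ hor i))/= ler_wpDr//.
  by apply: sumr_ge0 => i _; rewrite !mulr_ge0// invr_ge0 ltW.
apply: ler_sum => i ti.
have xi : x 0 i ^+ 2 <= rho ^+ 2.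
  apply: le_trans qx; rewrite /tail_sq (bigD1 i)//= -expr2 lerDl.
  by apply: sumr_ge0 => j _; rewrite -expr2 sqr_ge0.
rewrite -[leRHS]mul1r; apply: norm_mul_le => //.
have -> : M * (6 * (rho ^+ 2)^-1) = M * (4 * (rho ^+ 2)^-1) + M * ((rho ^+ 2)^-1 * 2).
  by ring.
apply: le_trans (ler_normD _ _) _; apply: lerD; apply: norm_mul_le => //; last first.
  by rewrite ger0_norm// mulr_ge0// invr_ge0 ltW.
rewrite ger0_norm ?sqr_ge0// exprMn exprMn.
have E : (rho ^+ 2)^-1 ^+ 2 * (2 ^+ 2 * rho ^+ 2) = 4 * (rho ^+ 2)^-1.
  by field; rewrite gt_eqF.
rewrite -E ler_wpM2l ?sqr_ge0// ler_wpM2l// sqr_ge0.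
Qed.

End operator_bounds.

(** * Dyadic sums *)

Lemma Rintegral_scaled_indic (d : measure_display) (T : measurableType d)
    (R : realType) (mu : {measure set T -> \bar R}) (S : set T) (c m : R) :
  measurable S -> mu S = m%:E ->
  mu.-integrable setT (fun x => (c * \1_S x)%:E) /\
  \int[mu]_x (c * \1_S x) = c * m.
Proof.
move=> mS muS.
have iS : mu.-integrable setT (fun x => (\1_S x : R)%:E).
  apply/integrableP; split; first exact/measurable_EFinP.
  under eq_integral do rewrite gee0_abs ?lee_fin//.
  by rewrite integral_indic// setIT muS ltry.
split; first by have := integrableZl measurableT c iS.
by rewrite RintegralZl// /Rintegral integral_indic// setIT muS.
Qed.

Lemma le_normr_Rintegral_indic (d : measure_display) (T : measurableType d)
    (R : realType) (mu : {measure set T -> \bar R}) (f : T -> R) (N : nat)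
    (a b : nat -> R) (A B : nat -> set T) (mA mB : nat -> R) :
  mu.-integrable setT (fun x => (f x)%:E) ->
  (forall k, measurable (A k)) -> (forall k, measurable (B k)) ->
  (forall k, mu (A k) = (mA k)%:E) -> (forall k, mu (B k) = (mB k)%:E) ->
  (forall x, `|f x| <= \sum_(k < N) (a k * \1_(A k) x + b k * \1_(B k) x)) ->
  `|\int[mu]_x f x| <= \sum_(k < N) (a k * mA k + b k * mB k).
Proof.
move=> intf msA msB muA muB fle.
have intk k : mu.-integrable setT
    (fun x => (a k * \1_(A k) x + b k * \1_(B k) x)%:E).
  have [iA _] := Rintegral_scaled_indic (a k) (msA k) (muA k).
  have [iB _] := Rintegral_scaled_indic (b k) (msB k) (muB k).
  by have := integrableD measurableT iA iB.
have -> : \sum_(k < N) (a k * mA k + b k * mB k) =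
    \int[mu]_x \sum_(k < N) (a k * \1_(A k) x + b k * \1_(B k) x).
  rewrite Rintegral_sum//; apply: eq_bigr => k _.
  have [iA eA] := Rintegral_scaled_indic (a k) (msA k) (muA k).
  have [iB eB] := Rintegral_scaled_indic (b k) (msB k) (muB k).
  by rewrite RintegralD// eA eB.
apply: le_trans (le_normr_Rintegral measurableT intf) _.
apply: le_Rintegral => //.
- by have := integrable_norm intf.
- have := @integrable_sum _ _ _ mu setT measurableT _ (index_enum 'I_N) xpredT
    (fun (k : 'I_N) x => (a k * \1_(A k) x + b k * \1_(B k) x)%:E).
  move=> /(_ (fun k _ => intk k)).
  by under eq_fun do rewrite sumEFin.
Qed.

(** The least power of [4] above [u]. *)
Lemma dyadic_scale (R : realType) (n : nat) (u : R) : 1 <= u -> u <= 4 ^+ n ->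
  exists2 k, (k <= n)%N & u <= 4 ^+ k /\ 4 ^+ k <= 4 * u.
Proof.
move=> u1 un; have ex : exists k, u <= 4 ^+ k by exists n.
have [k uk kmin] := ex_minnP ex.
exists k; first exact: kmin.
split=> //; case: k uk kmin => [|k] uk kmin; first by rewrite expr0; lra.
rewrite exprS ler_pM2l//; apply/ltW; rewrite ltNge; apply/negP => /kmin.
by rewrite ltnn.
Qed.

Lemma ln4_ge1 (R : realType) : 1 <= ln (4 : R).
Proof.
have p2 : (2 : R) \is Num.pos by rewrite posrE; lra.
have -> : (4 : R) = 2 * 2 by lra.
have h : ln (1 + (- (1 / 2))) <= - (1 / 2) :> R by apply: le_ln1Dx; lra.
have e : 1 + - (1 / 2) = 2^-1 :> R by lra.
rewrite e lnV// in h.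
by rewrite lnM//; lra.
Qed.

Lemma sum_half_powers (R : realType) (N : nat) :
  \sum_(k < N) (2 ^- k : R) <= 2.
Proof.
suff : \sum_(k < N) (2 ^- k : R) <= 2 - 2 * 2 ^- N.
  by move=> /le_trans; apply; rewrite gerBl mulr_ge0// invr_ge0 exprn_ge0.
elim: N => [|N IH]; first by rewrite big_ord0 expr0; lra.
rewrite big_ord_recr /=; apply: le_trans (lerD IH (lexx _)) _.
rewrite exprS invfM; have E : 2 * (2^-1 * 2 ^- N) = 2 ^- N :> R by field.
by rewrite E; lra.
Qed.

(** * Integral estimate of the operator *)

Lemma ln_expr4_ge (R : realType) (n : nat) : n%:R <= ln (4 ^+ n : R).
Proof. by rewrite lnXn// -(mulr_natl (ln 4) n) ler_peMr ?ler0n ?ln4_ge1. Qed.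

Lemma ln_expr4_ge1 (R : realType) (n : nat) : (2 <= n)%N -> 1 <= ln (4 ^+ n : R).
Proof.
by move=> n2; apply: le_trans (ln_expr4_ge R n); rewrite ler1n (leq_trans _ n2).
Qed.

Lemma ln3_lt_half (R : realType) (n : nat) : (2 <= n)%N ->
  ln 3 < ln (4 ^+ n : R) / 2.
Proof.
move=> n2; have h : ln 3 < ln 4 :> R by rewrite ltr_ln ?posrE//; lra.
have n2R : (2 : R) <= n%:R by rewrite ler_nat.
by rewrite lnXn// -(mulr_natl (ln 4) n); have := ln4_ge1 R; nra.
Qed.

Lemma natrM_succ_le (R : realType) (n : nat) :
  n%:R * (n%:R + 1) <= 2 * 4 ^+ n :> R.
Proof.
elim: n => [|p IH]; first by rewrite mul0r expr0; lra.
have h : 1 <= 4 ^+ p :> R by rewrite exprn_ege1//; lra.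
have h2 : p%:R + 1 <= 4 ^+ p :> R.
  elim: p {IH h} => [|p IH]; first by rewrite expr0 add0r.
  rewrite exprS -natr1; have : 0 <= p%:R :> R by []; lra.
by rewrite exprS -natr1; have : 0 <= p%:R :> R by []; nra.
Qed.

Section dyadic_estimate.
Context {R : realType} {m : nat} (hd : (3 <= m.+3)%N) (eta1 eta2 : R -> R).
Local Notation d := m.+3.
Hypotheses (smooth1 : smooth_R eta1) (smooth2 : smooth_R eta2).
Hypotheses (range1 : forall t, 0 <= eta1 t <= 1)
  (range2 : forall t, 0 <= eta2 t <= 1).
Hypothesis flat1 : forall t, t < 0 \/ 1 < t -> derive1 eta1 t = 0.
Hypothesis out2 : forall t, 1 < `|t| -> eta2 t = 0.
Hypothesis in2 : forall t, `|t| <= 1 / 2 -> eta2 t = 1.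
Variable M : R.
Hypothesis M1 : forall t, `|derive1 eta2 t| <= M.
Hypothesis M2 : forall t, `|derive1 (derive1 eta2) t| <= M.
Variable n : nat.
Hypothesis n2 : (2 <= n)%N.

Local Notation i1 := (Ordinal (ltnW (ltnW hd))).
Local Notation i2 := (Ordinal (ltnW hd)).
Local Notation L := (ln (4 ^+ n : R)).
Local Notation rho := (4 ^+ n : R).
Local Notation psi := (log_cutoff hd eta2 L (rho ^+ 2)).
Local Notation op := (corrector_operator hd eta1 eta2 psi).
Local Notation u := (bracket_sq hd).
Local Notation q := (tail_sq hd).
Local Notation leb := (lebesgue_rV R d).
Implicit Type x : 'rV[R]_d.

(** The sets on which the operator is bounded by a constant: [slab 2^k 2^k rho]
    contains the points with [x_1^2 + x_2^2] of order [4 ^ k], and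
    [slab 2^k 1 rho] those of them that lie in the strip. *)
Definition slab (a b c : R) (i : 'I_d) : R :=
  if i == i1 then a else if i == i2 then b else c.

Lemma lebesgue_slab a b c : 0 <= a -> 0 <= b -> 0 <= c ->
  leb (box (slab a b c)) = (a *+ 2 * (b *+ 2) * (c *+ 2) ^+ m.+1)%:E.
Proof.
move=> a0 b0 c0; rewrite lebesgue_box => [|i]; last first.
  by rewrite /slab; case: ifP => // _; case: ifP.
congr (_%:E); rewrite !big_ord_recl mulrA; congr (_ * _ * _).
- rewrite (eq_bigr (fun=> c *+ 2)) => [|i _]; last by [].
  by rewrite prodr_const card_ord exprS.
Qed.

Let rho_gt0 : 0 < rho. Proof. by rewrite exprn_gt0. Qed.
Let L_ge1 : 1 <= L. Proof. exact: ln_expr4_ge1. Qed.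

Definition core_coef (k : nat) : R :=
  M * (4 * L^-1 ^+ 2 * (4 / 4 ^+ k) + 4 * L^-1 * (4 / 4 ^+ k) ^+ 2
    + (6 * (rho ^+ 2)^-1) *+ d).

Definition strip_coef (k : nat) : R := M * (10 * L^-1 * (4 / 4 ^+ k)).

Let M0 : 0 <= M. Proof. exact: le_trans (normr_ge0 _) (M1 0). Qed.

Let l0 : 0 < L^-1.
Proof. by rewrite invr_gt0; apply: lt_le_trans L_ge1. Qed.

Lemma core_coef_ge0 k : 0 <= core_coef k.
Proof.
have p4 : 0 <= 4 / 4 ^+ k :> R by rewrite divr_ge0// exprn_ge0.
have r2 : 0 <= (rho ^+ 2)^-1 by rewrite invr_ge0 sqr_ge0.
apply: mulr_ge0 => //; apply: addr_ge0; last first.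
  by apply: mulrn_wge0; apply: mulr_ge0.
apply: addr_ge0; apply: mulr_ge0 => //; apply: mulr_ge0 => //.
  exact: sqr_ge0.
exact: ltW.
Qed.

Lemma strip_coef_ge0 k : 0 <= strip_coef k.
Proof.
have p4 : 0 <= 4 / 4 ^+ k :> R by rewrite divr_ge0// exprn_ge0.
by rewrite /strip_coef !mulr_ge0// ltW.
Qed.

Lemma sqr_le_normr (a b : R) : 0 <= b -> a * a <= b ^+ 2 -> `|a| <= b.
Proof.
move=> b0 ab; rewrite -(@ler_pXn2r _ 2)// ?nnegrE//.
by rewrite real_normK ?num_real// expr2.
Qed.

Lemma tail_coord_le x i c : 0 <= c -> q x <= c ^+ 2 -> ~~ horizontal hd i ->
  `|x 0 i| <= c.
Proof.
move=> c0 qx ti; apply: sqr_le_normr => //; apply: le_trans qx.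
rewrite /tail_sq (bigD1 i)//= lerDl.
by apply: sumr_ge0 => j _; rewrite -expr2 sqr_ge0.
Qed.

(** At each point a single term of the sum is used, the one whose dyadic scale is
    that of the point. *)
Lemma operator_dyadic_bound x :
  `|op x| <= \sum_(k < n.+1)
    (core_coef k * \1_(box (slab (2 ^+ k) (2 ^+ k) rho)) x +
     strip_coef k * \1_(box (slab (2 ^+ k) 1 rho)) x).
Proof.
have term0 (k : nat) : 0 <= core_coef k * \1_(box (slab (2 ^+ k) (2 ^+ k) rho)) x +
     strip_coef k * \1_(box (slab (2 ^+ k) 1 rho)) x.
  by rewrite addr_ge0// mulr_ge0 ?core_coef_ge0 ?strip_coef_ge0.
have [->|op0] := eqVneq (op x) 0.
  by rewrite normr0; apply: sumr_ge0 => k _; exact: term0.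
have [lnu qx] := operator_support smooth1 smooth2 out2 L_ge1 rho_gt0 op0.
have u4 : u x <= 4 ^+ n.
  by rewrite -ler_ln ?posrE ?bracket_sq_gt0// exprn_gt0.
have [k kn [uk ku]] := dyadic_scale (bracket_sq_ge1 hd x) u4.
rewrite (bigD1 (Ordinal (kn : (k < n.+1)%N)))//=; apply: ler_wpDr.
  by apply: sumr_ge0 => j _; exact: term0.
have u0 := bracket_sq_gt0 hd x.
have p4 : 0 < 4 ^+ k :> R by rewrite exprn_gt0.
have vk : (u x)^-1 <= 4 / 4 ^+ k.
  by rewrite ler_pdivlMr// mulrC ler_pdivrMr.
have v0 : 0 < (u x)^-1 by rewrite invr_gt0.
have E4 : 4 ^+ k = (2 ^+ k) ^+ 2 :> R.
  by rewrite -exprM mulnC exprM; congr (_ ^+ _); lra.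
have p2 : 0 <= 2 ^+ k :> R by rewrite exprn_ge0.
have abk : x 0 i1 * x 0 i1 + x 0 i2 * x 0 i2 <= (2 ^+ k) ^+ 2.
  by move: uk; rewrite E4 /bracket_sq; lra.
have x1 : `|x 0 i1| <= 2 ^+ k.
  by apply: sqr_le_normr => //; have := sqr_ge0 (x 0 i2); rewrite expr2; lra.
have x2 : `|x 0 i2| <= 2 ^+ k.
  by apply: sqr_le_normr => //; have := sqr_ge0 (x 0 i1); rewrite expr2; lra.
have xtail i : i != i1 -> i != i2 -> `|x 0 i| <= rho.
  move=> ii1 ii2; apply: (tail_coord_le (ltW rho_gt0) qx).
  by rewrite /horizontal negb_or ii1.
have inA : box (slab (2 ^+ k) (2 ^+ k) rho) x.
  move=> i; rewrite /slab; case: eqVneq => [->//|ii1].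
  by case: eqVneq => [->//|ii2]; exact: xtail.
have indB : ((`|x 0 i2| <= 1)%R)%:R <= \1_(box (slab (2 ^+ k) 1 rho)) x :> R.
  rewrite indicE; case: (leP `|x 0 i2| 1) => // x21.
  rewrite mem_set// => i; rewrite /slab; case: eqVneq => [->//|ii1].
  by case: eqVneq => [->//|ii2]; exact: xtail.
rewrite indicE mem_set// mulr1.
have := operator_bound smooth1 smooth2 range1 range2 flat1 out2 in2 M1 M2
  L_ge1 rho_gt0 (ln3_lt_half R n2) qx.
move=> /le_trans; apply; rewrite mulrDr; apply: lerD.
  rewrite /core_coef ler_wpM2l// lerD2r lerD//.
    by rewrite ler_wpM2l// mulr_ge0// sqr_ge0.
  rewrite ler_wpM2l//; first by rewrite mulr_ge0// ltW.
  by rewrite lerXn2r// nnegrE ltW// divr_gt0.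
rewrite /strip_coef -(mulrA M) ler_wpM2l// [leRHS]mulrC.
apply: ler_pM => //; first by rewrite !mulr_ge0// ltW.
by rewrite ler_wpM2l// mulr_ge0// ltW.
Qed.

Let massA (k : nat) : R := 2 ^+ k *+ 2 * (2 ^+ k *+ 2) * (rho *+ 2) ^+ m.+1.
Let massB (k : nat) : R := 2 ^+ k *+ 2 * (1 *+ 2) * (rho *+ 2) ^+ m.+1.

(** The term of order [1 / L^2] contributes equally at each of the [n + 1] scales
    and gains from [L] being at least [n]; the other logarithmic terms form
    geometric series with a factor [1 / L]; the last one is of order
    [(n + 1) / rho] with [rho = 4 ^ n]. *)
Lemma dyadic_mass_bound :
  \sum_(k < n.+1) (core_coef k * massA k + strip_coef k * massB k) <=
  M * (rho *+ 2) ^+ m.+1 * ((960 + 48 * d%:R) / n%:R).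
Proof.
set P := (rho *+ 2) ^+ m.+1; set l := L^-1.
have P0 : 0 <= P by rewrite exprn_ge0// mulrn_wge0// exprn_ge0.
have n0 : 0 < n%:R :> R by rewrite ltr0n (leq_trans _ n2).
have r0 := rho_gt0.
have lN : l <= n%:R^-1.
  rewrite lef_pV2 ?posrE ?ln_expr4_ge//.
  exact: lt_le_trans n0 (ln_expr4_ge R n).
have term k : (k < n.+1)%N -> core_coef k * massA k + strip_coef k * massB k <=
    M * P * (64 * l ^+ 2 + 24 * d%:R * rho^-1 + 416 * l * 2 ^- k).
  move=> kn; set t : R := 2 ^+ k.
  have t1 : 1 <= t by rewrite exprn_ege1//; lra.
  have t0 : 0 < t by lra.
  have E4 : 4 ^+ k = t ^+ 2.
    by rewrite -exprM mulnC exprM; congr (_ ^+ _); lra.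
  have trho : t ^+ 2 <= rho by rewrite -E4 ler_eXn2l// ltr1n.
  have -> : core_coef k * massA k + strip_coef k * massB k =
    M * P * (64 * l ^+ 2 + 24 * d%:R * (t ^+ 2 / rho * rho^-1)
      + (256 * t^-1 + 160) * l * t^-1).
    rewrite /core_coef /strip_coef /massA /massB -/P -/l -/t E4.
    rewrite -(mulr_natr (6 * _) d); set dR : R := d%:R; set r := rho.
    by field; rewrite !gt_eqF.
  have tr : t ^+ 2 / rho <= 1 by rewrite ler_pdivrMr// mul1r.
  have ti : t^-1 <= 1 by rewrite invf_le1.
  rewrite ler_wpM2l// ?mulr_ge0// lerD//.
    rewrite lerD2l ler_wpM2l// ?mulr_ge0//.
    by rewrite ler_piMl// invr_ge0 ltW.
  rewrite -/t ler_wpM2r ?invr_ge0 ?(ltW t0)// ler_wpM2r ?(ltW l0)//; lra.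
apply: (@le_trans _ _ (\sum_(k < n.+1)
    M * P * (64 * l ^+ 2 + 24 * d%:R * rho^-1 + 416 * l * 2 ^- k))).
  by apply: ler_sum => k _; exact: term.
rewrite -mulr_sumr ler_wpM2l ?mulr_ge0// big_split /= sumr_const card_ord.
rewrite -mulr_sumr -(mulr_natl _ n.+1) -natr1.
have := sum_half_powers R n.+1; set S := \sum_(i < _) _ => S2.
have rn : (n%:R + 1) * rho^-1 <= 2 * n%:R^-1.
  rewrite ler_pdivrMr// mulrC mulrA ler_pdivlMr// mulrC; have := natrM_succ_le R n; lra.
have dd : 0 <= d%:R :> R by [].
have nS : l ^+ 2 * (n%:R + 1) <= 2 * n%:R^-1.
  apply: (@le_trans _ _ (n%:R^-1 ^+ 2 * (n%:R + 1))).
    rewrite ler_wpM2r ?addr_ge0// lerXn2r ?nnegrE ?invr_ge0//.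
    exact: le_trans ler01 L_ge1.
  have -> : n%:R^-1 ^+ 2 * (n%:R + 1) = n%:R^-1 * (1 + n%:R^-1) :> R.
    by field; rewrite gt_eqF.
  rewrite mulrC ler_wpM2r ?invr_ge0//.
  have : n%:R^-1 <= 1 :> R by rewrite invf_le1// ler1n (leq_trans _ n2).
  lra.
have lS : l * S <= 2 * n%:R^-1.
  rewrite mulrC; apply: ler_pM => //; last exact: ltW.
  by apply: sumr_ge0 => k _; rewrite invr_ge0 exprn_ge0.
have -> : (n%:R + 1) * (64 * l ^+ 2 + 24 * d%:R / rho) + 416 * l * S =
  64 * (l ^+ 2 * (n%:R + 1)) + 24 * (d%:R * ((n%:R + 1) * rho^-1))
  + 416 * (l * S) by ring.
have drn : d%:R * ((n%:R + 1) * rho^-1) <= d%:R * (2 * n%:R^-1).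
  by rewrite ler_wpM2l.
lra.
Qed.

Lemma support_box x i : ln (u x) <= L -> q x <= rho ^+ 2 -> `|x 0 i| <= rho.
Proof.
move=> lnu qx; have r0 := ltW rho_gt0.
have ur : u x <= rho by rewrite -ler_ln ?posrE ?bracket_sq_gt0// rho_gt0.
have r1 : 1 <= rho by rewrite exprn_ege1//; lra.
have abr : x 0 i1 * x 0 i1 + x 0 i2 * x 0 i2 <= rho ^+ 2.
  by move: ur; rewrite /bracket_sq; nra.
have [hi|ti] := boolP (horizontal hd i); last exact: (tail_coord_le r0 qx ti).
case/orP: hi => /eqP ->; apply: sqr_le_normr => //.
  by have := sqr_ge0 (x 0 i2); rewrite expr2; lra.
by have := sqr_ge0 (x 0 i1); rewrite expr2; lra.
Qed.

Lemma integral_operator_bound (f : 'rV[R]_d -> R) (K : R) :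
  leb.-integrable setT (fun x => (f x * op x)%:E) ->
  0 <= K ->
  (forall x, (forall i, `|x 0 i| <= rho) -> `|f x| <= K) ->
  `|\int[leb]_x (f x * op x)| <=
    K * (M * (rho *+ 2) ^+ m.+1 * ((960 + 48 * d%:R) / n%:R)).
Proof.
move=> intf K0 fK.
have r0 := ltW rho_gt0.
have p2 (k : nat) : 0 <= 2 ^+ k :> R by rewrite exprn_ge0.
apply: le_trans (ler_wpM2l K0 dyadic_mass_bound); rewrite mulr_sumr.
have -> : \sum_(k < n.+1) K * (core_coef k * massA k + strip_coef k * massB k) =
  \sum_(k < n.+1) (K * core_coef k * massA k + K * strip_coef k * massB k).
  by apply: eq_bigr => k _; rewrite mulrDr !mulrA.
apply: (@le_normr_Rintegral_indic _ _ _ leb _ n.+1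
  (fun k => K * core_coef k) (fun k => K * strip_coef k)
  (fun k => box (slab (2 ^+ k) (2 ^+ k) rho)) (fun k => box (slab (2 ^+ k) 1 rho))
  massA massB) => //.
- by move=> k; exact: measurable_boxn.
- by move=> k; exact: measurable_boxn.
- by move=> k; apply: lebesgue_slab.
- by move=> k; apply: lebesgue_slab.
move=> x; have [->|op0] := eqVneq (op x) 0.
  rewrite mulr0 normr0; apply: sumr_ge0 => k _.
  apply: addr_ge0; apply: mulr_ge0 => //; apply: mulr_ge0 => //.
    exact: core_coef_ge0.
  exact: strip_coef_ge0.
apply: (@le_trans _ _ (K * `|op x|)); last first.
  apply: (le_trans (ler_wpM2l K0 (operator_dyadic_bound x))).
  by rewrite mulr_sumr; apply: ler_sum => k _ /=; rewrite mulrDr !mulrA.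
rewrite normrM ler_wpM2r// fK// => i.
have [lnu qx] := operator_support smooth1 smooth2 out2 L_ge1 rho_gt0 op0.
exact: support_box.
Qed.

End dyadic_estimate.

(** * Mass of the source *)

Section source_term.
Context {R : realType} {m : nat} (hd : (3 <= m.+3)%N) (eta1 eta2 : R -> R).
Local Notation d := m.+3.
Hypotheses (smooth1 : smooth_R eta1) (smooth2 : smooth_R eta2).
Hypotheses (range1 : forall t, 0 <= eta1 t <= 1)
  (range2 : forall t, 0 <= eta2 t <= 1).
Hypothesis low1 : forall t, t < 0 -> eta1 t = 0.
Hypothesis high1 : forall t, 1 < t -> eta1 t = 1.
Hypothesis out2 : forall t, 1 < `|t| -> eta2 t = 0.
Hypothesis in2 : forall t, `|t| <= 1 / 2 -> eta2 t = 1.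
Variable n : nat.
Hypothesis n2 : (2 <= n)%N.

Local Notation i1 := (Ordinal (ltnW (ltnW hd))).
Local Notation i2 := (Ordinal (ltnW hd)).
Local Notation L := (ln (4 ^+ n : R)).
Local Notation rho := (4 ^+ n : R).
Local Notation psi := (log_cutoff hd eta2 L (rho ^+ 2)).
Local Notation eta := (Defs.eta hd eta1 eta2).
Local Notation u := (bracket_sq hd).
Local Notation q := (tail_sq hd).
Local Notation leb := (lebesgue_rV R d).
Implicit Type x : 'rV[R]_d.


Let rho_gt0 : 0 < rho. Proof. by rewrite exprn_gt0. Qed.
Let L_ge1 : 1 <= L. Proof. exact: ln_expr4_ge1. Qed.

Lemma flat1 t : t < 0 \/ 1 < t -> derive1 eta1 t = 0.
Proof.
move=> [t0|t1].
  apply: (@derive1_locally_cst _ _ 0).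
  by apply: filterS (lt_nbhsl t0) => s; exact: low1.
apply: (@derive1_locally_cst _ _ 1).
by apply: filterS (lt_nbhsr t1) => s; exact: high1.
Qed.

Let bounded_psi : bounded_support psi.
Proof.
exists rho => x psi0 i; have [lnu qx] := log_cutoff_support out2 L_ge1 rho_gt0 psi0.
exact: support_box.
Qed.

(** A primitive of [d_1 eta psi] in the direction [x_1]: the logarithmic factor
    of [psi] is dropped, as it is [1] wherever [d_1 eta] is nonzero. *)
Let f x : R := eta1 (x 0 ord0) * (eta2 (x 0 i2) * eta2 ((rho ^+ 2)^-1 * q x)).

Let i1E : i1 = ord0. Proof. exact: val_inj. Qed.

Let elementary_f : elementary f.
Proof.
have ecoord (k : R -> R) i : smooth_R k -> elementary (fun x : 'rV[R]_d => k (x 0 i)).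
  by move=> sk; apply: elementary_comp => //; exact: elementary_coord.
apply: elementaryM; first exact: ecoord.
apply: elementaryM; first exact: ecoord.
apply: elementary_comp => //; apply: elementaryM; first exact: elementary_cst.
by apply: elementary_sum => i _; apply: elementaryM; exact: elementary_coord.
Qed.

Let partial_f x : partial ord0 f x = partial i1 eta x * psi x.
Proof.
have -> : partial ord0 f x =
    derive1 eta1 (x 0 ord0) * (eta2 (x 0 i2) * eta2 ((rho ^+ 2)^-1 * q x)).
  apply: partial_at.
  have := is_derive_mul
    (smooth_R_chain smooth1 (is_derive_coord ord0 ord0 x))
    (is_derive_mul (smooth_R_chain smooth2 (is_derive_coord i2 ord0 x))
      (is_derive_tail_factor hd (rho ^+ 2) ord0 x smooth2)).
  have h0 : horizontal hd ord0 by rewrite /horizontal i1E eqxx.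
  have i20 : (i2 == ord0) = false by [].
  by move/is_derive_eq; apply; rewrite eqxx h0 i20 /=; ring.
rewrite partial_eta// i1E /log_cutoff.
have [b1|b1] := lerP `|x 0 i2| 1; last by rewrite (out2 b1) !(mul0r, mulr0).
have [a0|a0] := ltP (x 0 ord0) 0; first by rewrite flat1 ?mul0r//; left.
have [a1|a1] := ltP 1 (x 0 ord0); first by rewrite flat1 ?mul0r//; right.
rewrite (in2 (t := _ * ln _)); first by ring.
by apply: ltW; apply: (log_factor_near_origin L_ge1 (ln3_lt_half R n2));
  rewrite ?i1E.
Qed.

(** The jump of [f] across the slab [0 <= x_1 <= 1] is [eta2 (x_2)] times the
    tail factor, which is at least the indicator of a box of sides [1] and
    [2 rho / d]. *)
Lemma source_lower_bound :
  (rho / d%:R *+ 2) ^+ m.+1 <= \int[leb]_x (partial i1 eta x * psi x).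
Proof.
have r0 := rho_gt0.
have r1 : 1 <= rho by rewrite exprn_ege1//; lra.
have d0 : 0 < d%:R :> R by rewrite ltr0n.
have -> : (fun x => partial i1 eta x * psi x) = partial ord0 f.
  by apply/funext => x; rewrite partial_f.
pose G v := f (rV_cons (2, v)).
have bpf : bounded_support (partial ord0 f).
  have -> : partial ord0 f = (fun x => partial i1 eta x * psi x).
    by apply/funext => x; rewrite partial_f.
  exact: bounded_supportM bounded_psi.
have far t v : 2 < `|t| -> partial ord0 f (rV_cons (t, v)) = 0.
  move=> t2; rewrite partial_f partial_eta// i1E rV_cons0 flat1 ?mul0r//.
  by have [t0|t0] := ltP t 0; [left|right; move: t2; rewrite ger0_norm//; lra].
have two0 : 0 < 2 :> R by [].
have fG v : f (rV_cons (2, v)) - f (rV_cons (- 2, v)) = G v.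
  by rewrite [X in _ - X]/f rV_cons0 low1 ?mul0r ?subr0//; lra.
rewrite (integral_partial_step elementary_f bpf two0 far fG).
pose side (j : 'I_m.+2) : R := if j == ord0 then 1 / 2 else rho / d%:R.
have side0 j : 0 <= side j.
  by rewrite /side; case: ifP => // _; rewrite divr_ge0// ltW.
have boxE : lebesgue_rV R m.+2 (box side) = ((rho / d%:R *+ 2) ^+ m.+1)%:E.
  rewrite lebesgue_box//; congr (_%:E); rewrite big_ord_recl.
  rewrite (eq_bigr (fun=> rho / d%:R *+ 2)) => [|i _]; last by [].
  rewrite prodr_const card_ord {1}/side eqxx.
  have -> : 1 / 2 *+ 2 = 1 :> R by lra.
  by rewrite mul1r.
have [iI eI] := Rintegral_scaled_indic 1 (measurable_boxn side) boxE.
rewrite -[leLHS]mul1r -eI.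
have bG : bounded_support G.
  exists rho => v Gv j.
  have [q1|q1] := lerP (q (rV_cons (2, v))) (rho ^+ 2); last first.
    move: Gv; rewrite /G /f [X in _ * (_ * X)]out2 ?mulr0 ?eqxx//.
    by apply: tail_factor_out.
  have [v1|v1] := lerP `|v 0 ord0| 1; last first.
    have : `|rV_cons (2, v) 0 i2| > 1.
      by have -> : i2 = lift ord0 ord0 by [exact: val_inj]; rewrite rV_consS.
    by move=> /out2 e; move: Gv; rewrite /G /f e mul0r mulr0 eqxx.
  have [->|j0] := eqVneq j ord0; first exact: le_trans v1 r1.
  rewrite -(rV_consS 2 v j); apply: (tail_coord_le (ltW r0) q1).
  by rewrite /horizontal negb_or.
have eG := elementary_slice 2 elementary_f.
apply: le_Rintegral => //; first exact: elementary_integrable.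
move=> v _; rewrite mul1r indicE.
have p01 t : 0 <= eta2 t by have /andP[] := range2 t.
have q01 t : 0 <= eta1 t by have /andP[] := range1 t.
case: (boolP (v \in box side)) => [|_]; last by rewrite /f !mulr_ge0.
rewrite inE => vside; rewrite /G /f rV_cons0 high1; last by lra.
have i2E : i2 = lift ord0 ord0 by exact: val_inj.
rewrite i2E rV_consS (in2 (t := v 0 ord0)); last exact: (vside ord0).
rewrite in2 ?mulr1// ger0_norm ?mulr_ge0 ?invr_ge0 ?sqr_ge0 ?tail_sq_ge0//.
rewrite mulrC ler_pdivrMr ?exprn_gt0//.
apply: (@le_trans _ _ (\sum_(i < d) (rho / d%:R) ^+ 2)).
  rewrite [leRHS](bigID (fun i => ~~ horizontal hd i))/= ler_wpDr//.
    by apply: sumr_ge0 => i _; rewrite sqr_ge0.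
  apply: ler_sum => i; case: (unliftP ord0 i) => [j|] -> ti; last first.
    by move: ti; rewrite /horizontal i1E eqxx.
  have j0 : (j == ord0) = false.
    by apply: contraNF ti => /eqP ->; rewrite /horizontal i2E eqxx orbT.
  rewrite rV_consS -expr2 -real_normK ?num_real// lerXn2r ?nnegrE//.
  by have := vside j; rewrite /side j0.
rewrite sumr_const card_ord -(mulr_natl ((rho / d%:R) ^+ 2) d).
have -> : d%:R * (rho / d%:R) ^+ 2 = rho ^+ 2 * d%:R^-1 by field; rewrite gt_eqF.
rewrite mulrC ler_wpM2r ?sqr_ge0//.
have d2 : 2 <= d%:R :> R by rewrite ler_nat.
by rewrite div1r lef_pV2 ?posrE.
Qed.

End source_term.

(** * Oscillation at a fixed distance *)

Section oscillation.
Context {R : realType} {d : nat}.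
Implicit Types (x y z p w : 'rV[R]_d) (f : 'rV[R]_d -> R).

Lemma dot_combination (a b : R) x y :
  dot (a *: x + b *: y) (a *: x + b *: y) =
  a ^+ 2 * dot x x + 2 * a * b * dot x y + b ^+ 2 * dot y y.
Proof.
rewrite /dot !mulr_sumr -!big_split /=; apply: eq_bigr => i _.
by rewrite !mxE; ring.
Qed.

Lemma dot_linear_r (a b : R) x y z :
  dot z (a *: x + b *: y) = a * dot z x + b * dot z y.
Proof.
rewrite /dot !mulr_sumr -big_split /=; apply: eq_bigr => i _.
by rewrite !mxE; ring.
Qed.

Lemma exists_orthogonal y (i j : 'I_d) : i != j ->
  exists2 w, dot y w = 0 & 0 < dot w w.
Proof.
move=> ij; have [yi0|yi] := eqVneq (y 0 i) 0.
  exists (ebasis i); first by rewrite dot_ebasis.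
  by rewrite dot_ebasis mxE !eqxx.
exists (y 0 j *: ebasis i + (- y 0 i) *: ebasis j).
  by rewrite dot_linear_r !dot_ebasis; ring.
rewrite dot_combination !dot_ebasis !mxE !eqxx (eq_sym j i) (negbTE ij) /=.
have : 0 < y 0 i ^+ 2 by rewrite lt_neqAle sqr_ge0 eq_sym sqrf_eq0 yi.
have := sqr_ge0 (y 0 j); nra.
Qed.

(** The apex of an isosceles triangle over the segment, built on a vector
    orthogonal to it; this is where the dimension has to be at least two. *)
Lemma equidistant_point x y (i j : 'I_d) (r : R) : i != j -> 0 <= r ->
  dot (x - y) (x - y) <= (2 * r) ^+ 2 ->
  exists z, enorm (x - z) = r /\ enorm (z - y) = r.
Proof.
move=> ij r0 xy; have [w w_orth w0] := exists_orthogonal (x - y) ij.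
pose t := Num.sqrt ((r ^+ 2 - dot (x - y) (x - y) / 4) / dot w w).
have tE : t ^+ 2 * dot w w = r ^+ 2 - dot (x - y) (x - y) / 4.
  rewrite sqr_sqrtr; first by rewrite mulfVK// gt_eqF.
  by rewrite divr_ge0// ?(ltW w0)//; move: xy; rewrite exprMn; lra.
exists (y + (2^-1 *: (x - y) + t *: w)).
have normE (s : R) : s ^+ 2 = t ^+ 2 ->
    enorm (2^-1 *: (x - y) + s *: w) = r.
  move=> st; rewrite /enorm dot_combination w_orth st tE.
  have -> : 2^-1 ^+ 2 * dot (x - y) (x - y) + 2 * 2^-1 * s * 0 +
    (r ^+ 2 - dot (x - y) (x - y) / 4) = r ^+ 2 by field.
  by rewrite sqrtr_sqr ger0_norm.
split; last by rewrite addrC addKr normE.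
have -> : x - (y + (2^-1 *: (x - y) + t *: w)) = 2^-1 *: (x - y) + (- t) *: w.
  by apply/rowP => k; rewrite !mxE; field.
by rewrite normE// sqrrN.
Qed.

(** Split the segment into [N] equal pieces of length at most [2 r], each of which
    costs [2 K]. *)
Lemma oscillation_chain f (r K : R) (i j : 'I_d) (N : nat) x y :
  i != j -> 0 <= r ->
  (forall p z, enorm (p - z) = r -> `|f p - f z| <= K) ->
  (0 < N)%N -> dot (x - y) (x - y) <= (2 * r * N%:R) ^+ 2 ->
  `|f x - f y| <= 2 * K * N%:R.
Proof.
move=> ij r0 fK N0 xy.
have step p z : dot (p - z) (p - z) <= (2 * r) ^+ 2 -> `|f p - f z| <= 2 * K.
  move=> /(equidistant_point ij r0)[s [/fK ps /fK sz]].
  have -> : f p - f z = (f p - f s) + (f s - f z) by ring.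
  by apply: le_trans (ler_normD _ _) _; lra.
have NR : 0 < N%:R :> R by rewrite ltr0n.
pose pt (k : nat) := y + (k%:R / N%:R) *: (x - y).
have chain k : `|f (pt k) - f y| <= 2 * K * k%:R.
  elim: k => [|k IH]; first by rewrite /pt mul0r scale0r addr0 subrr normr0 mulr0.
  have -> : f (pt k.+1) - f y = (f (pt k.+1) - f (pt k)) + (f (pt k) - f y) by ring.
  have -> : 2 * K * k.+1%:R = 2 * K + 2 * K * k%:R.
    by rewrite -[k.+1%:R]natr1; ring.
  apply: le_trans (ler_normD _ _) _; rewrite lerD//.
  apply: step.
  have -> : pt k.+1 - pt k = N%:R^-1 *: (x - y) + 0 *: (x - y).
    by apply/rowP => l; rewrite !mxE -[k.+1%:R]natr1; field; rewrite gt_eqF.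
  rewrite dot_combination expr0n /= mulr0 !mul0r !addr0 exprVn.
  by rewrite ler_pdivrMl ?exprn_gt0// mulrC -exprMn.
have := chain N; rewrite /pt divff ?gt_eqF// scale1r.
by have -> : y + (x - y) = x by rewrite addrC subrK.
Qed.

Lemma enorm_sub_le x y (B : R) : enorm x <= B -> enorm y <= B ->
  enorm (x - y) <= 2 * B.
Proof.
move=> xB yB; have B0 : 0 <= B by apply: le_trans xB; exact: sqrtr_ge0.
have sq z : enorm z <= B -> dot z z <= B ^+ 2.
  by rewrite -enorm_sqr => zB; rewrite lerXn2r// nnegrE sqrtr_ge0.
rewrite -[leRHS]ger0_norm ?mulr_ge0// -sqrtr_sqr ler_wsqrtr//.
have Em : x - y = 1 *: x + (-1) *: y by rewrite scale1r scaleN1r.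
have := dotxx_ge0 (1 *: x + 1 *: y); rewrite Em !dot_combination.
by have := sq _ xB; have := sq _ yB; nra.
Qed.

End oscillation.

Lemma exists_scale (R : realType) (x : R) : 16 <= x ->
  exists n, [/\ (2 <= n)%N, 4 ^+ n <= x & x < 4 ^+ n.+1].
Proof.
move=> x16; have ex : exists n, x < 4 ^+ n.
  have [N xN] : exists N, x < N%:R.
    by exists (Num.bound x); apply: archi_boundP; lra.
  exists N; apply: lt_le_trans xN _.
  by rewrite -natrX ler_nat ltnW// ltn_expl.
have [n xn nmin] := ex_minnP ex.
have n3 : (3 <= n)%N.
  rewrite ltnNge; apply/negP => n2.
  have : 4 ^+ n <= 4 ^+ 2 :> R by rewrite ler_weXn2l//; lra.
  by rewrite !exprS expr0; lra.
case: n n3 xn nmin => [//|n] n3 xn nmin; exists n; split=> //.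
by rewrite leNgt; apply/negP => /nmin; rewrite ltnn.
Qed.

(** * Logarithmic growth of the corrector *)

(** Compare the lower bound on the source with the upper bound on the operator;
    the factors [rho ^ (d-2)] cancel. *)
Lemma scale_le_oscillation (R : realType) (m : nat) (hd : (3 <= m.+3)%N)
    (eta1 eta2 : R -> R) (M K c : R) (n : nat) (f : 'rV[R]_m.+3 -> R) :
  smooth_R eta1 -> smooth_R eta2 ->
  (forall t, 0 <= eta1 t <= 1) -> (forall t, 0 <= eta2 t <= 1) ->
  (forall t, t < 0 -> eta1 t = 0) -> (forall t, 1 < t -> eta1 t = 1) ->
  (forall t, 1 < `|t| -> eta2 t = 0) ->
  (forall t, `|t| <= 1 / 2 -> eta2 t = 1) ->
  (forall t, `|derive1 eta2 t| <= M) ->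
  (forall t, `|derive1 (derive1 eta2) t| <= M) ->
  (2 <= n)%N ->
  corrector (acoef hd eta1 eta2) (Ordinal (ltnW (ltnW hd))) f ->
  (forall x : 'rV[R]_m.+3, (forall i, `|x 0 i| <= 4 ^+ n) -> `|f x - c| <= K) ->
  n%:R <= K * (M * m.+3%:R ^+ m.+1 * (960 + 48 * m.+3%:R)).
Proof.
move=> s1 s2 rg1 rg2 low1 high1 out2 in2 M1 M2 n2 cf fK.
have K0 : 0 <= K.
  apply: (le_trans (normr_ge0 (f 0 - c))); apply: fK => i.
  by rewrite mxE normr0 exprn_ge0.
have fl := flat1 low1 high1.
have rho0 : 0 < 4 ^+ n :> R by rewrite exprn_gt0.
have epsi := elementary_log_cutoff hd s2 (ln (4 ^+ n)) ((4 ^+ n) ^+ 2).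
have bpsi : bounded_support (log_cutoff hd eta2 (ln (4 ^+ n)) ((4 ^+ n) ^+ 2)).
  exists (4 ^+ n) => x psi0 i.
  have [lnu qx] := log_cutoff_support out2 (ln_expr4_ge1 R n2) rho0 psi0.
  exact: support_box.
have [iop eop] := integral_corrector_operator_center s1 s2 epsi bpsi c cf.
have := integral_operator_bound s1 s2 rg1 rg2 fl out2 in2 M1 M2 n2 iop K0 fK.
have := source_lower_bound hd s1 s2 rg1 rg2 low1 high1 out2 in2 n2.
rewrite eop normrN; set S := Rintegral _ _ _; set P := (4 ^+ n *+ 2) ^+ m.+1.
have P0 : 0 < P by rewrite exprn_gt0// pmulrn_lgt0.
have d0 : 0 < m.+3%:R :> R by rewrite ltr0n.
have D0 : 0 < m.+3%:R ^+ m.+1 :> R by rewrite exprn_gt0.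
have n0 : 0 < n%:R :> R by rewrite ltr0n (leq_trans _ n2).
have -> : (4 ^+ n / m.+3%:R *+ 2) ^+ m.+1 = P / m.+3%:R ^+ m.+1.
  by rewrite -mulrnAl exprMn exprVn.
move=> low /(le_trans (le_trans low (ler_norm _))).
rewrite ler_pdivrMr// => le1.
rewrite -(ler_pM2l P0) -ler_pdivlMr//; apply: le_trans le1 _.
rewrite le_eqVlt; apply/orP; left; apply/eqP.
by field; rewrite gt_eqF.
Qed.

Theorem proposition2 (R : realType) (d : nat) (hd : (3 <= d)%N)
    (eta1 eta2 : R -> R)
    (smooth1 : smooth_R eta1) (smooth2 : smooth_R eta2)
    (range1 : forall t, 0 <= eta1 t <= 1) (range2 : forall t, 0 <= eta2 t <= 1)
    (supp1 : [/\ `[1, +oo[%classic `<=` [set t | eta1 t = 1],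
                 [set t | eta1 t = 1] `<=` supp eta1 &
                 supp eta1 `<=` `[0, +oo[%classic])
    (supp2 : [/\ `[- (1 / 2), 1 / 2]%classic `<=` [set t | eta2 t = 1],
                 [set t | eta2 t = 1] `<=` supp eta2 &
                 supp eta2 `<=` `[-1, 1]%classic]) :
  exists2 C : R, 0 < C &
    forall phi : 'rV[R]_d -> 'rV[R]_d,
      (forall j : 'I_d,
         corrector (acoef hd eta1 eta2) j (fun x => phi x 0 j)
         /\ strictly_sublinear (fun x => phi x 0 j)) ->
      (forall r : R, 1 <= r ->
         exists x x' : 'rV[R]_d,
           C * ln (2 + r) <= enorm (phi x - phi x') /\ enorm (x - x') = r)
      /\ ~ (exists M : R, forall x : 'rV[R]_d, enorm (phi x) <= M).
Proof.
case: d hd => [|[|[|m]]] hd; [by []|by []|by []|].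
have low1 t : t < 0 -> eta1 t = 0.
  move=> t0; apply/eqP/negPn/negP => et; have [_ _ /(_ t)] := supp1.
  move=> /(_ (@subset_closure _ [set s | eta1 s != 0] t et)) /=.
  by rewrite in_itv /=; lra.
have high1 t : 1 < t -> eta1 t = 1.
  by move=> t1; have [/(_ t) + _ _] := supp1; apply; rewrite /= in_itv /= ltW.
have out2 t : 1 < `|t| -> eta2 t = 0.
  move=> t1; apply/eqP/negPn/negP => et; have [_ _ /(_ t)] := supp2.
  move=> /(_ (@subset_closure _ [set s | eta2 s != 0] t et)) /=.
  by rewrite in_itv /= -ler_norml leNgt t1.
have in2 t : `|t| <= 1 / 2 -> eta2 t = 1.
  move=> t1; have [/(_ t) + _ _] := supp2; apply.
  by rewrite /= in_itv /= -ler_norml.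
have sd := smooth_R_derive1 smooth2.
have cd := smooth_R_continuous sd.
have cd2 := smooth_R_continuous (smooth_R_derive1 sd).
have [Ma Ma0 MaP] := bounded_of_support ltr01 cd (@out2_derive _ _ out2).
have [Mb Mb0 MbP] := bounded_of_support ltr01 cd2 (@out2_derive2 _ _ out2).
have [M M0 [M1 M2]] : exists2 M : R, 0 < M &
    (forall t, `|derive1 eta2 t| <= M) /\
    (forall t, `|derive1 (derive1 eta2) t| <= M).
  exists (Ma + Mb); first exact: addr_gt0.
  by split=> t; [apply: le_trans (MaP t) _; rewrite lerDl ltW|
    apply: le_trans (MbP t) _; rewrite lerDr ltW].
have [dR dRE] : exists dR : R, dR = m.+3%:R by exists m.+3%:R.
have dR3 : 3 <= dR by rewrite dRE ler_nat.
have [S SE] : exists S : R, S = 16 * dR * (M * dR ^+ m.+1 * (960 + 48 * dR)).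
  by eexists.
have S0 : 0 < S.
  have d0 : 0 < dR by lra.
  rewrite SE; apply: mulr_gt0; first lra.
  apply: mulr_gt0; last lra.
  by apply: mulr_gt0 => //; exact: exprn_gt0.
have l4 := ln4_ge1 R.
pose C : R := (4 * ln 4 * S)^-1.
have C0 : 0 < C by rewrite invr_gt0 mulr_gt0//; lra.
exists C => // phi phiP.
pose i1 : 'I_m.+3 := Ordinal (ltnW (ltnW hd)).
pose i2 : 'I_m.+3 := Ordinal (ltnW hd).
have far r : 1 <= r -> exists x x' : 'rV[R]_m.+3,
    C * ln (2 + r) <= enorm (phi x - phi x') /\ enorm (x - x') = r.
  move=> r1; apply: contrapT => nex.
  pose K := C * ln (2 + r).
  have fK p z : enorm (p - z) = r -> `|phi p 0 i1 - phi z 0 i1| <= K.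
    move=> pz; rewrite leNgt; apply/negP => Klt; apply: nex; exists p, z.
    split=> //; apply: (le_trans (ltW Klt)).
    by have := coord_le_enorm (phi p - phi z) i1; rewrite !mxE.
  have [n [n2 nr rn]] : exists n,
      [/\ (2 <= n)%N, 4 ^+ n <= 16 * r & 16 * r < 4 ^+ n.+1].
    by apply: exists_scale; lra.
  have r0 : 0 <= r by lra.
  have i12 : i1 != i2 by [].
  have osc (x : 'rV[R]_m.+3) : (forall i, `|x 0 i| <= 4 ^+ n) ->
      `|phi x 0 i1 - phi 0 0 i1| <= 16 * dR * K.
    move=> xbox.
    have -> : 16 * dR * K = 2 * K * (8 * m.+3)%:R by rewrite natrM -dRE; ring.
    apply: (oscillation_chain (f := fun x => phi x 0 i1) i12 r0 fK) => //.
    rewrite subr0; apply: (@le_trans _ _ (dR * (16 * r) ^+ 2)).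
      rewrite /dot dRE mulr_natl -[X in _ *+ X]card_ord -sumr_const.
      apply: ler_sum => i _; rewrite -expr2 -real_normK ?num_real//.
      by rewrite lerXn2r ?nnegrE//; [lra|exact: le_trans (xbox i) nr].
    have -> : (2 * r * (8 * m.+3)%:R) ^+ 2 = dR ^+ 2 * (16 * r) ^+ 2.
      by rewrite natrM -dRE; ring.
    by rewrite ler_wpM2r ?sqr_ge0//; nra.
  have [cphi _] := phiP i1.
  have := scale_le_oscillation smooth1 smooth2 range1 range2 low1 high1 out2 in2
    M1 M2 n2 cphi osc.
  have -> : 16 * dR * K * (M * m.+3%:R ^+ m.+1 * (960 + 48 * m.+3%:R)) = K * S.
    by rewrite SE -dRE; ring.
  have n0 : 2 <= n%:R :> R by rewrite ler_nat.
  have lnr : ln (2 + r) <= 2 * n%:R * ln 4.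
    apply: (@le_trans _ _ (ln (4 ^+ n.+1))).
      by rewrite ler_ln ?posrE ?exprn_gt0//; lra.
    by rewrite lnXn// -(mulr_natl (ln 4) n.+1) -natr1; nra.
  rewrite leNgt => /negP; apply.
  apply: (@le_lt_trans _ _ (n%:R / 2)); last by lra.
  have -> : K * S = ln (2 + r) / (4 * ln 4).
    by rewrite /K /C; field; rewrite !gt_eqF//; lra.
  by rewrite ler_pdivrMr; lra.
split=> // -[B phiB].
have B0 : 0 <= B by apply: le_trans (phiB 0); exact: sqrtr_ge0.
pose r := expR ((2 * B + 1) / C).
have r1 : 1 <= r by rewrite -expR0 ler_expR divr_ge0 ?ltW//; lra.
have [x [x' [xx' _]]] := far r r1.
have := enorm_sub_le (phiB x) (phiB x').
have : ln r <= ln (2 + r) by rewrite ler_ln ?posrE; lra.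
rewrite expRK ler_pdivrMr// => h1 h2; lra.
Qed.
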